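(* A string with characters $(m,\ell)$ is closed (i.e. periodic) if and only if $\mathtt p(m,\ell)>0$ and $\Theta_2(m,\ell),\Theta_3(m,\ell)\in\mathbb Q$.
   Context: $\mathbb C^{2,1}$ is $\mathbb C^3$ with $\langle z,w\rangle=i(\bar z^1w^3-\bar z^3w^1)+\bar z^2w^2$; $\mathcal S=\{[z]\in\mathbb{CP}^2:\langle z,z\rangle=0\}$ with contact distribution $\ker\zeta$, $\zeta=-\frac{i}{\bar z^tz}\langle z,dz\rangle|_{T\mathcal S}$; Legendrian curves are immersions tangent to it. For a normalized lift $\Gamma$ ($\gamma=[\Gamma]$, $\det(\Gamma,\Gamma',\Gamma'')=i$) set $a=\mathrm{Im}\langle\Gamma''',\Gamma''\rangle$, $b=\frac12\langle\Gamma'',\Gamma''\rangle$. A generic Legendrian curve ($a$ never zero) is naturally parameterized if $a\equiv1$; then $\kappa=b$ is its cr-curvature. A string is a natural parameterization $\gamma:\mathbb R\to\mathcal S$ of a generic Legendrian curve with vanishing stress tensor (for $a\equiv1$ this is equivalent to $\kappa'''+8\kappa\kappa'=0$) whose cr-curvature is non-constant and periodic. Every such $\kappa$ equals $\kappa_{m,\ell}(u+u_0)$ for a unique $(m,\ell)\in(0,1)\times(0,\infty)$ (the characters) and some $u_0$, where $\kappa_{m,\ell}(u)=\frac32\ell^2\big(\frac{m+1}3-m\,\mathrm{sn}^2(\ell u,m)\big)$, $\mathrm{sn}(\cdot,m)$ being the Jacobi elliptic sine with parameter $m$ (square of the modulus). Set $\mathtt p(m,\ell)=64\big(m^2(m-1)^2\ell^{12}+2(m-2)(1+m)(2m-1)\ell^6-27\big)$.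 When $\mathtt p(m,\ell)>0$ put $\sigma=\sqrt{1-m+m^2}$, $\widetilde{\mathtt p}=\frac{(m-2)(1+m)(2m-1)\ell^6-27}{2\sigma^3\ell^6}\in(-1,1)$, $\alpha=\frac13\arcsin\widetilde{\mathtt p}$, and $\lambda_2=-\frac43\sigma\ell^2\sin\alpha$, $\lambda_3=\frac23\sigma\ell^2\sin\alpha+\frac2{\sqrt3}\sigma\ell^2\cos\alpha$, $\lambda_1=-\lambda_2-\lambda_3$, and for $j=2,3$ $$\Theta_j(m,\ell)=\frac{6\,\Pi\!\left(\frac{6m\ell^2}{2(1+m)\ell^2+3\lambda_j},m\right)}{\pi\ell\,(2(1+m)\ell^2+3\lambda_j)}=\frac3\pi\int_0^{2K(m)/\ell}\frac{du}{4\kappa_{m,\ell}(u)+3\lambda_j},$$ where $K(m)$ and $\Pi(n,m)=\int_0^{\pi/2}\frac{d\theta}{(1-n\sin^2\theta)\sqrt{1-m\sin^2\theta}}$ are the complete elliptic integrals of the first and third kind. *)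

(* Defs.v *)
From Stdlib Require Import Reals Lra ZArith ClassicalEpsilon.
Open Scope R_scope.

Record C := mkC { Re : R; Im : R }.
Definition C0 : C := mkC 0 0.
Definition Ci : C := mkC 0 1.
Definition Cadd (z w : C) : C := mkC (Re z + Re w) (Im z + Im w).
Definition Copp (z : C) : C := mkC (- Re z) (- Im z).
Definition Csub (z w : C) : C := Cadd z (Copp w).
Definition Cmul (z w : C) : C :=
  mkC (Re z * Re w - Im z * Im w) (Re z * Im w + Im z * Re w).
Definition Cconj (z : C) : C := mkC (Re z) (- Im z).
Definition RtoC (x : R) : C := mkC x 0.

Record C3 := mkC3 { c1 : C; c2 : C; c3 : C }.
Definition zero3 : C3 := mkC3 C0 C0 C0.
Definition scale3 (a : C) (z : C3) : C3 := mkC3 (Cmul a (c1 z)) (Cmul a (c2 z)) (Cmul a (c3 z)).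

Definition herm (z w : C3) : C :=
  Cadd (Cmul Ci (Csub (Cmul (Cconj (c1 z)) (c3 w)) (Cmul (Cconj (c3 z)) (c1 w))))
       (Cmul (Cconj (c2 z)) (c2 w)).

Definition eucl2 (z : C3) : R :=
  Re (c1 z) ^ 2 + Im (c1 z) ^ 2 + Re (c2 z) ^ 2 + Im (c2 z) ^ 2
  + Re (c3 z) ^ 2 + Im (c3 z) ^ 2.

Definition zeta (z dz : C3) : C := Cmul (RtoC (- / eucl2 z)) (Cmul Ci (herm z dz)).

Definition det3 (x y z : C3) : C :=
  Cadd (Csub (Cmul (c1 x) (Csub (Cmul (c2 y) (c3 z)) (Cmul (c3 y) (c2 z))))
             (Cmul (c2 x) (Csub (Cmul (c1 y) (c3 z)) (Cmul (c3 y) (c1 z)))))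
       (Cmul (c3 x) (Csub (Cmul (c1 y) (c2 z)) (Cmul (c2 y) (c1 z)))).

Definition has_deriv3 (F F' : R -> C3) : Prop :=
  forall u,
    derivable_pt_lim (fun t => Re (c1 (F t))) u (Re (c1 (F' u))) /\
    derivable_pt_lim (fun t => Im (c1 (F t))) u (Im (c1 (F' u))) /\
    derivable_pt_lim (fun t => Re (c2 (F t))) u (Re (c2 (F' u))) /\
    derivable_pt_lim (fun t => Im (c2 (F t))) u (Im (c2 (F' u))) /\
    derivable_pt_lim (fun t => Re (c3 (F t))) u (Re (c3 (F' u))) /\
    derivable_pt_lim (fun t => Im (c3 (F t))) u (Im (c3 (F' u))).

(* Points of CP^2 are represented by nonzero vectors of C^3 (homogeneous
   coordinates); [z] = [w] iff w is a nonzero complex multiple of z. *)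
Definition proj_eq (z w : C3) : Prop :=
  z <> zero3 /\ exists a : C, a <> C0 /\ w = scale3 a z.

(* G n is the n-th derivative of the lift Gamma = G 0 (so Gamma is smooth). *)
Definition normalized_natural_lift (G : nat -> R -> C3) : Prop :=
  (forall n, has_deriv3 (G n) (G (S n))) /\
  (forall u, G 0%nat u <> zero3) /\
  (forall u, herm (G 0%nat u) (G 0%nat u) = C0) /\
  (* immersion: gamma' <> 0 in CP^2 *)
  (forall u, ~ exists a : C, G 1%nat u = scale3 a (G 0%nat u)) /\
  (* Legendrian: tangent to ker zeta *)
  (forall u, zeta (G 0%nat u) (G 1%nat u) = C0) /\
  (forall u, det3 (G 0%nat u) (G 1%nat u) (G 2%nat u) = Ci) /\
  (forall u, Im (herm (G 3%nat u) (G 2%nat u)) = 1).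

(* b = (1/2) <Gamma'', Gamma''> (a real number); for a = 1 this is the cr-curvature *)
Definition cr_curvature (G : nat -> R -> C3) (u : R) : R :=
  Re (herm (G 2%nat u) (G 2%nat u)) / 2.

(* Riemann integral of f over [a,b] (oriented), when it exists *)
Definition Rint (f : R -> R) (a b : R) : R :=
  epsilon (inhabits 0) (fun I => exists pr : Riemann_integrable f a b, RiemannInt pr = I).

Definition ellF (phi m : R) : R :=
  Rint (fun t => / sqrt (1 - m * sin t ^ 2)) 0 phi.

Definition jam (u m : R) : R := epsilon (inhabits 0) (fun phi => ellF phi m = u).

Definition sn (u m : R) : R := sin (jam u m).

Definition ellK (m : R) : R := ellF (PI / 2) m.

Definition ellPi (n m : R) : R :=
  Rint (fun t => / ((1 - n * sin t ^ 2) * sqrt (1 - m * sin t ^ 2))) 0 (PI / 2).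

Definition kappa_ml (m l u : R) : R :=
  3 / 2 * l ^ 2 * ((m + 1) / 3 - m * sn (l * u) m ^ 2).

Definition is_string_with_characters (gamma : R -> C3) (m l : R) : Prop :=
  exists G : nat -> R -> C3,
    normalized_natural_lift G /\
    (forall u, proj_eq (G 0%nat u) (gamma u)) /\
    (* vanishing stress tensor: kappa''' + 8 kappa kappa' = 0 *)
    (exists k1 k2 k3 : R -> R, forall u,
        derivable_pt_lim (cr_curvature G) u (k1 u) /\
        derivable_pt_lim k1 u (k2 u) /\
        derivable_pt_lim k2 u (k3 u) /\
        k3 u + 8 * cr_curvature G u * k1 u = 0) /\
    (exists u1 u2, cr_curvature G u1 <> cr_curvature G u2) /\
    (exists T, 0 < T /\ forall u, cr_curvature G (u + T) = cr_curvature G u) /\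
    (exists u0, forall u, cr_curvature G u = kappa_ml m l (u + u0)).

Definition closed_curve (gamma : R -> C3) : Prop :=
  exists T, 0 < T /\ forall u, proj_eq (gamma u) (gamma (u + T)).

Definition pp (m l : R) : R :=
  64 * (m ^ 2 * (m - 1) ^ 2 * l ^ 12 + 2 * (m - 2) * (1 + m) * (2 * m - 1) * l ^ 6 - 27).

Definition sigma (m : R) : R := sqrt (1 - m + m ^ 2).

Definition ptilde (m l : R) : R :=
  ((m - 2) * (1 + m) * (2 * m - 1) * l ^ 6 - 27) / (2 * sigma m ^ 3 * l ^ 6).

Definition alpha (m l : R) : R := asin (ptilde m l) / 3.

Definition lambda2 (m l : R) : R := - (4 / 3) * sigma m * l ^ 2 * sin (alpha m l).

Definition lambda3 (m l : R) : R :=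
  2 / 3 * sigma m * l ^ 2 * sin (alpha m l) + 2 / sqrt 3 * sigma m * l ^ 2 * cos (alpha m l).

Definition Theta (lam m l : R) : R :=
  6 * ellPi (6 * m * l ^ 2 / (2 * (1 + m) * l ^ 2 + 3 * lam)) m
  / (PI * l * (2 * (1 + m) * l ^ 2 + 3 * lam)).

Definition Theta2 (m l : R) : R := Theta (lambda2 m l) m l.
Definition Theta3 (m l : R) : R := Theta (lambda3 m l) m l.

Definition is_rational (x : R) : Prop :=
  exists p q : Z, (q <> 0)%Z /\ x = IZR p / IZR q.

(* Main.v *)
(* A normalized lift G satisfies G''' = (i - k') G - 2 k G', where k is the cr-curvature. When
   k'' + 4 k^2 is a constant c, the operator A = D^2 + (4/3) k preserves the solution space of this
   equation, and its eigenfunctions Y_mu satisfy (2k/3 + mu) Y' = (k'/3 + i) Y: for real mu they are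
   |2k/3 + mu|^(1/2) e^(i theta) times a constant, with theta' = 1 / (2k/3 + mu). The eigenvalues are
   mu_j = lambda_j / 2, and p(m,l) is a positive multiple of the discriminant of their cubic. If it is
   positive, Y_j is multiplied by e^(2 pi i Theta_j) over a period of k, and
   Theta_1 + Theta_2 + Theta_3 = 0. If it is negative, |Y_mu| is not periodic for a nonreal eigenvalue
   mu; if it is zero, a generalized eigenvector at the double eigenvalue is not periodic. A period of
   the curve is a multiple of the period of k, and it acts on the lift by a cube root of unity. *)

(* With [L = D^3 + 2 k D + k'] the structure equation is [L z = i z], and [[L, A] = (k''' + 8 k k')
   / 3]: the vanishing of the stress tensor is exactly the commutation of [L] and [A]. For an
   eigenfunction, [Y'' = (mu - 4k/3) Y]; differentiating this and comparing with [L Y = i Y]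
   eliminates the higher derivatives and leaves the first-order relation, which is solved by a
   quadrature. The projection to an eigenspace is an explicit expression in [z], [z'], [z'']. The
   eigenfunctions are therefore built from the coordinates of the given lift, and neither a
   monodromy matrix nor an existence theorem for linear equations enters. The price is that the
   eigenfunction of a single coordinate may vanish identically; the Wronskian excludes this only for
   the three coordinates together. Dividing by [2k/3 + mu] is harmless: at a root of the cubic this
   factor has no zero, because its product with the other two is [-(1 + k'^2/9)]. *)
From Pilot Require Import Defs.
From Stdlib Require Import Reals ZArith.
From Stdlib Require Import Lra Lia ClassicalEpsilon.
From Coquelicot Require Import Hierarchy Continuity Derive RInt RInt_analysis.
Import Pilot.Defs.
Open Scope R_scope.

(** * Complex numbers *)

Definition Cone : C := RtoC 1.

Declare Scope cx_scope.
Delimit Scope cx_scope with cx.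
Bind Scope cx_scope with C.
Infix "+" := Cadd : cx_scope.
Infix "-" := Csub : cx_scope.
Infix "*" := Cmul : cx_scope.
Notation "- x" := (Copp x) : cx_scope.

Lemma C_eq (z w : C) : Re z = Re w -> Im z = Im w -> z = w.
Proof. destruct z, w; simpl; congruence. Qed.

Ltac C_reals := apply C_eq; simpl.

Lemma C_ring : ring_theory C0 Cone Cadd Cmul Csub Copp (@eq C).
Proof. constructor; intros; C_reals; ring. Qed.

Add Ring C_ring_inst : C_ring.

Lemma Ci_sq : (Ci * Ci = - Cone)%cx.
Proof. C_reals; ring. Qed.

Lemma Cconj_add (z w : C) : Cconj (z + w)%cx = (Cconj z + Cconj w)%cx.
Proof. C_reals; ring. Qed.

Lemma Cconj_sub (z w : C) : Cconj (z - w)%cx = (Cconj z - Cconj w)%cx.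
Proof. C_reals; ring. Qed.

Lemma Cconj_mul (z w : C) : Cconj (z * w)%cx = (Cconj z * Cconj w)%cx.
Proof. C_reals; ring. Qed.

Lemma Cconj_conj (z : C) : Cconj (Cconj z) = z.
Proof. C_reals; ring. Qed.

Lemma Cconj_i : Cconj Ci = (- Ci)%cx.
Proof. C_reals; ring. Qed.

Definition Cnorm2 (z : C) : R := Re z ^ 2 + Im z ^ 2.

Lemma Cnorm2_mul (z w : C) : Cnorm2 (z * w)%cx = Cnorm2 z * Cnorm2 w.
Proof. unfold Cnorm2; simpl; ring. Qed.

Lemma Cnorm2_ge0 (z : C) : 0 <= Cnorm2 z.
Proof. unfold Cnorm2; nra. Qed.

Lemma Cnorm2_eq0 (z : C) : Cnorm2 z = 0 -> z = C0.
Proof. unfold Cnorm2; intros; C_reals; nra. Qed.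

Lemma Cnorm2_pos (z : C) : z <> C0 -> 0 < Cnorm2 z.
Proof.
  intros Hz; destruct (Cnorm2_ge0 z) as [H|H]; [exact H|].
  destruct Hz; apply Cnorm2_eq0; auto.
Qed.

Lemma Cmul_integral (z w : C) : (z * w)%cx = C0 -> z = C0 \/ w = C0.
Proof.
  intros H.
  assert (E : Cnorm2 z * Cnorm2 w = 0).
  { rewrite <- Cnorm2_mul, H; unfold Cnorm2; simpl; ring. }
  apply Rmult_integral in E as [E|E]; [left|right]; now apply Cnorm2_eq0.
Qed.

Definition Cinv (z : C) : C := mkC (Re z / Cnorm2 z) (- Im z / Cnorm2 z).

Lemma Cinv_l (z : C) : z <> C0 -> (Cinv z * z)%cx = Cone.
Proof.
  intros Hz; pose proof (Cnorm2_pos z Hz) as H; unfold Cnorm2 in *.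
  C_reals; unfold Cnorm2; field; lra.
Qed.

Lemma Cmul_neq0 (z w : C) : z <> C0 -> w <> C0 -> (z * w)%cx <> C0.
Proof. intros Hz Hw E; destruct (Cmul_integral _ _ E); auto. Qed.

Lemma Cone_neq0 : Cone <> C0.
Proof. intros E; apply (f_equal Re) in E; simpl in E; lra. Qed.

Lemma Cinv_neq0 (z : C) : z <> C0 -> Cinv z <> C0.
Proof.
  intros Hz E; apply Cone_neq0; rewrite <- (Cinv_l z Hz), E; ring.
Qed.

(** * Derivatives *)

(** Splits a derivative computation in two: [eapply] lets the rules produce whatever value they
    yield, and its equality with the wanted value is left to algebra. *)
Lemma D_val (f : R -> R) (x l l' : R) :
  derivable_pt_lim f x l -> l = l' -> derivable_pt_lim f x l'.
Proof. intros H <-; exact H. Qed.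

Lemma D_const (c x : R) : derivable_pt_lim (fun _ => c) x 0.
Proof. exact (derivable_pt_lim_const c x). Qed.

Lemma D_id (x : R) : derivable_pt_lim (fun t => t) x 1.
Proof. exact (derivable_pt_lim_id x). Qed.

Lemma D_plus (f g : R -> R) (x a b : R) :
  derivable_pt_lim f x a -> derivable_pt_lim g x b ->
  derivable_pt_lim (fun t => f t + g t) x (a + b).
Proof. exact (derivable_pt_lim_plus f g x a b). Qed.

Lemma D_minus (f g : R -> R) (x a b : R) :
  derivable_pt_lim f x a -> derivable_pt_lim g x b ->
  derivable_pt_lim (fun t => f t - g t) x (a - b).
Proof. exact (derivable_pt_lim_minus f g x a b). Qed.

Lemma D_opp (f : R -> R) (x a : R) :
  derivable_pt_lim f x a -> derivable_pt_lim (fun t => - f t) x (- a).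
Proof. exact (derivable_pt_lim_opp f x a). Qed.

Lemma D_mult (f g : R -> R) (x a b : R) :
  derivable_pt_lim f x a -> derivable_pt_lim g x b ->
  derivable_pt_lim (fun t => f t * g t) x (a * g x + f x * b).
Proof. exact (derivable_pt_lim_mult f g x a b). Qed.

Lemma D_comp (f g : R -> R) (x a b : R) :
  derivable_pt_lim g x b -> derivable_pt_lim f (g x) a ->
  derivable_pt_lim (fun t => f (g t)) x (a * b).
Proof. exact (derivable_pt_lim_comp g f x b a). Qed.

Lemma D_div (f g : R -> R) (x a b : R) :
  derivable_pt_lim f x a -> derivable_pt_lim g x b -> g x <> 0 ->
  derivable_pt_lim (fun t => f t / g t) x ((a * g x - f x * b) / (g x) ^ 2).
Proof.
  intros Hf Hg Hn; eapply D_val; [exact (derivable_pt_lim_div f g x a b Hf Hg Hn)|].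
  unfold Rsqr; field; exact Hn.
Qed.

Lemma D_pow (f : R -> R) (n : nat) (x a : R) :
  derivable_pt_lim f x a ->
  derivable_pt_lim (fun t => f t ^ n) x (INR n * f x ^ pred n * a).
Proof.
  intros Hf; apply (D_comp (fun y => y ^ n) f); [exact Hf|apply derivable_pt_lim_pow].
Qed.

Lemma D_shift (f : R -> R) (x c a : R) :
  derivable_pt_lim f (x + c) a -> derivable_pt_lim (fun t => f (t + c)) x a.
Proof.
  intros Hf; eapply D_val;
    [apply (D_comp f (fun t => t + c)); [apply D_plus; [apply D_id|apply D_const]|exact Hf]|ring].
Qed.

Lemma derivative_zero_constant (f : R -> R) :
  (forall u, derivable_pt_lim f u 0) -> forall u v, f u = f v.
Proof.
  intros H.
  assert (W : forall u v, u < v -> f u = f v).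
  { intros u v Huv; destruct (MVT_cor2 f (fun _ => 0) u v Huv) as [c [E _]];
      [intros; apply H|lra]. }
  intros u v; destruct (Rtotal_order u v) as [?|[->|?]]; [auto|auto|symmetry; auto].
Qed.

Lemma derivative_pos_increasing (f f' : R -> R) :
  (forall u, derivable_pt_lim f u (f' u)) -> (forall u, 0 < f' u) ->
  forall u v, u < v -> f u < f v.
Proof.
  intros H Hp u v Huv; destruct (MVT_cor2 f f' u v Huv) as [c [E _]]; [intros; apply H|].
  specialize (Hp c); nra.
Qed.

Definition derivC (f f' : R -> C) : Prop :=
  forall u, derivable_pt_lim (fun t => Re (f t)) u (Re (f' u)) /\
            derivable_pt_lim (fun t => Im (f t)) u (Im (f' u)).

Lemma derivC_ext (f f' g' : R -> C) :
  derivC f f' -> (forall u, f' u = g' u) -> derivC f g'.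
Proof. intros H E u; rewrite <- E; apply H. Qed.

Lemma derivC_add (f f' g g' : R -> C) :
  derivC f f' -> derivC g g' -> derivC (fun u => f u + g u)%cx (fun u => f' u + g' u)%cx.
Proof.
  intros Hf Hg u; destruct (Hf u), (Hg u); split; simpl; apply D_plus; assumption.
Qed.

Lemma derivC_sub (f f' g g' : R -> C) :
  derivC f f' -> derivC g g' -> derivC (fun u => f u - g u)%cx (fun u => f' u - g' u)%cx.
Proof.
  intros Hf Hg u; destruct (Hf u), (Hg u); split; simpl; (apply D_plus; [|apply D_opp]); assumption.
Qed.

Lemma derivC_mul (f f' g g' : R -> C) :
  derivC f f' -> derivC g g' ->
  derivC (fun u => f u * g u)%cx (fun u => f' u * g u + f u * g' u)%cx.
Proof.
  intros Hf Hg u; destruct (Hf u), (Hg u); split; simpl;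
    (eapply D_val; [first [apply D_minus|apply D_plus]; apply D_mult; eassumption|simpl; ring]).
Qed.

Lemma derivC_conj (f f' : R -> C) :
  derivC f f' -> derivC (fun u => Cconj (f u)) (fun u => Cconj (f' u)).
Proof.
  intros Hf u; destruct (Hf u); split; simpl; [|apply D_opp]; assumption.
Qed.

Lemma derivC_const (c : C) : derivC (fun _ => c) (fun _ => C0).
Proof. intros u; split; simpl; apply D_const. Qed.

Lemma derivC_RtoC (f f' : R -> R) :
  (forall u, derivable_pt_lim f u (f' u)) ->
  derivC (fun u => RtoC (f u)) (fun u => RtoC (f' u)).
Proof. intros H u; split; simpl; [apply H|apply D_const]. Qed.

Lemma derivC_shift (f f' : R -> C) (T : R) :
  derivC f f' -> derivC (fun u => f (u + T)) (fun u => f' (u + T)).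
Proof.
  intros H u; destruct (H (u + T)); split;
    [apply (D_shift (fun t => Re (f t)))|apply (D_shift (fun t => Im (f t)))]; assumption.
Qed.

(** This is how identities get differentiated: new relations between derivatives of the lift are
    drawn from earlier ones through it. *)
Lemma derivC_unique (f g f' g' : R -> C) :
  derivC f f' -> derivC g g' -> (forall u, f u = g u) -> forall u, f' u = g' u.
Proof.
  intros Hf Hg E u; destruct (Hf u) as [A B], (Hg u) as [A' B']; apply C_eq.
  - apply (uniqueness_limite (fun t => Re (f t)) u); [exact A|].
    apply (derivable_pt_lim_ext (fun t => Re (g t))); [intros; now rewrite E|exact A'].
  - apply (uniqueness_limite (fun t => Im (f t)) u); [exact B|].
    apply (derivable_pt_lim_ext (fun t => Im (g t))); [intros; now rewrite E|exact B'].
Qed.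

Lemma derivC_of_constant (f f' : R -> C) (c : C) :
  derivC f f' -> (forall u, f u = c) -> forall u, f' u = C0.
Proof.
  intros Hf E; exact (derivC_unique f (fun _ => c) f' _ Hf (derivC_const c) E).
Qed.

(** * The Hermitian form and the structure equation *)

Lemma has_deriv3_iff (F F' : R -> C3) :
  has_deriv3 F F' ->
  derivC (fun u => c1 (F u)) (fun u => c1 (F' u)) /\
  derivC (fun u => c2 (F u)) (fun u => c2 (F' u)) /\
  derivC (fun u => c3 (F u)) (fun u => c3 (F' u)).
Proof. intros H; repeat split; apply (H u). Qed.

Lemma derivC_herm (F F' H H' : R -> C3) :
  has_deriv3 F F' -> has_deriv3 H H' ->
  derivC (fun u => herm (F u) (H u)) (fun u => herm (F' u) (H u) + herm (F u) (H' u))%cx.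
Proof.
  intros [F1 [F2 F3]]%has_deriv3_iff [H1 [H2 H3]]%has_deriv3_iff.
  unfold herm; eapply derivC_ext.
  - apply derivC_add; [apply derivC_mul; [apply derivC_const|apply derivC_sub]|];
      apply derivC_mul; try apply derivC_conj; eassumption.
  - intros u; cbv beta; ring.
Qed.

Lemma derivC_det3 (X X' Y Y' Z Z' : R -> C3) :
  has_deriv3 X X' -> has_deriv3 Y Y' -> has_deriv3 Z Z' ->
  derivC (fun u => det3 (X u) (Y u) (Z u))
    (fun u => det3 (X' u) (Y u) (Z u) + det3 (X u) (Y' u) (Z u) + det3 (X u) (Y u) (Z' u))%cx.
Proof.
  intros [X1 [X2 X3]]%has_deriv3_iff [Y1 [Y2 Y3]]%has_deriv3_iff [Z1 [Z2 Z3]]%has_deriv3_iff.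
  unfold det3; eapply derivC_ext.
  - repeat first [eassumption|apply derivC_sub|apply derivC_add|apply derivC_mul].
  - intros u; cbv beta; ring.
Qed.

Lemma herm_conj (z w : C3) : herm w z = Cconj (herm z w).
Proof.
  unfold herm; rewrite !Cconj_add, !Cconj_mul, !Cconj_sub, !Cconj_mul, !Cconj_conj, Cconj_i; ring.
Qed.

Lemma eucl2_pos (z : C3) : z <> zero3 -> 0 < eucl2 z.
Proof.
  destruct z as [[a b] [c d] [e f]]; unfold eucl2; simpl; intros Hz.
  destruct (Rle_lt_dec (a ^ 2 + b ^ 2 + c ^ 2 + d ^ 2 + e ^ 2 + f ^ 2) 0) as [H|H]; [|lra].
  destruct Hz; unfold zero3, C0; repeat f_equal; nra.
Qed.

Lemma zeta_eq0 (z dz : C3) : z <> zero3 -> zeta z dz = C0 -> herm z dz = C0.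
Proof.
  intros Hz%eucl2_pos; unfold zeta; intros [H|[H|H]%Cmul_integral]%Cmul_integral; [| |exact H].
  - apply (f_equal Re) in H; simpl in H; apply Rinv_0_lt_compat in Hz; lra.
  - apply (f_equal Im) in H; simpl in H; lra.
Qed.

(** The Gram matrix factors through the matrix of the form, whose determinant is -1 (signature
    (2,1)); this is the sign on the right. *)
Lemma gram_det (x1 x2 x3 y1 y2 y3 : C3) :
  det3 (mkC3 (herm x1 y1) (herm x1 y2) (herm x1 y3))
       (mkC3 (herm x2 y1) (herm x2 y2) (herm x2 y3))
       (mkC3 (herm x3 y1) (herm x3 y2) (herm x3 y3))
  = (- (Cconj (det3 x1 x2 x3) * det3 y1 y2 y3))%cx.
Proof.
  unfold det3, herm; simpl.
  rewrite ?Cconj_add, ?Cconj_sub, ?Cconj_mul, ?Cconj_add, ?Cconj_sub, ?Cconj_mul.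
  ring [Ci_sq].
Qed.

Lemma C3_eq (z w : C3) : c1 z = c1 w -> c2 z = c2 w -> c3 z = c3 w -> z = w.
Proof. destruct z, w; simpl; congruence. Qed.

Lemma herm_nondegenerate (x y z v : C3) :
  det3 x y z <> C0 -> herm x v = C0 -> herm y v = C0 -> herm z v = C0 -> v = zero3.
Proof.
  intros Hd Hx Hy Hz.
  assert (Hd' : Cconj (det3 x y z) <> C0).
  { intros E; apply Hd; rewrite <- (Cconj_conj (det3 x y z)), E; C_reals; ring. }
  set (X1 := Cconj (c1 x)); set (X2 := Cconj (c2 x)); set (X3 := Cconj (c3 x)).
  set (Y1 := Cconj (c1 y)); set (Y2 := Cconj (c2 y)); set (Y3 := Cconj (c3 y)).
  set (Z1 := Cconj (c1 z)); set (Z2 := Cconj (c2 z)); set (Z3 := Cconj (c3 z)).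
  assert (Ed : Cconj (det3 x y z) =
    (X1 * (Y2 * Z3 - Y3 * Z2) - X2 * (Y1 * Z3 - Y3 * Z1) + X3 * (Y1 * Z2 - Y2 * Z1))%cx).
  { unfold det3; rewrite ?Cconj_add, ?Cconj_sub, ?Cconj_mul, ?Cconj_sub, ?Cconj_mul; reflexivity. }
  (* Cramer's rule for the covector dual to v, whose entries are i v3, v2, -i v1 *)
  assert (E3 : (Cconj (det3 x y z) * (Ci * c3 v))%cx = C0).
  { transitivity ((Y2 * Z3 - Y3 * Z2) * herm x v + (Z2 * X3 - Z3 * X2) * herm y v
                  + (X2 * Y3 - X3 * Y2) * herm z v)%cx;
      [|rewrite Hx, Hy, Hz; ring].
    rewrite Ed; unfold herm; fold X1 X2 X3 Y1 Y2 Y3 Z1 Z2 Z3; ring. }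
  assert (E2 : (Cconj (det3 x y z) * c2 v)%cx = C0).
  { transitivity ((Y3 * Z1 - Y1 * Z3) * herm x v + (Z3 * X1 - Z1 * X3) * herm y v
                  + (X3 * Y1 - X1 * Y3) * herm z v)%cx;
      [|rewrite Hx, Hy, Hz; ring].
    rewrite Ed; unfold herm; fold X1 X2 X3 Y1 Y2 Y3 Z1 Z2 Z3; ring. }
  assert (E1 : (Cconj (det3 x y z) * (Ci * c1 v))%cx = C0).
  { transitivity (- ((Y1 * Z2 - Y2 * Z1) * herm x v + (Z1 * X2 - Z2 * X1) * herm y v
                  + (X1 * Y2 - X2 * Y1) * herm z v))%cx;
      [|rewrite Hx, Hy, Hz; ring].
    rewrite Ed; unfold herm; fold X1 X2 X3 Y1 Y2 Y3 Z1 Z2 Z3; ring. }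
  assert (Hi : Ci <> C0) by (intros E; apply (f_equal Im) in E; simpl in E; lra).
  apply C3_eq; simpl.
  - destruct (Cmul_integral _ _ E1) as [?|E]; [tauto|destruct (Cmul_integral _ _ E); tauto].
  - destruct (Cmul_integral _ _ E2); tauto.
  - destruct (Cmul_integral _ _ E3) as [?|E]; [tauto|destruct (Cmul_integral _ _ E); tauto].
Qed.

Lemma Cconj_C0 : Cconj C0 = C0.
Proof. C_reals; ring. Qed.

Lemma herm_self_real (z : C3) : Im (herm z z) = 0.
Proof. pose proof (f_equal Im (herm_conj z z)) as H; simpl Im in H at 2; lra. Qed.

(** The later analysis sees the lift as three scalar solutions of one linear equation, and
    quantifies over them in this way. *)
Definition coordinate (p : C3 -> C) : Prop := p = c1 \/ p = c2 \/ p = c3.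

Section NormalizedLift.

Variable G : nat -> R -> C3.
Hypothesis HG : normalized_natural_lift G.

Lemma lift_deriv (n : nat) : has_deriv3 (G n) (G (S n)).
Proof. apply HG. Qed.

Lemma lift_herm_deriv (i j : nat) :
  derivC (fun u => herm (G i u) (G j u))
    (fun u => herm (G (S i) u) (G j u) + herm (G i u) (G (S j) u))%cx.
Proof. apply derivC_herm; apply lift_deriv. Qed.

Lemma lift_h00 (u : R) : herm (G 0 u) (G 0 u) = C0.
Proof. apply HG. Qed.

Lemma lift_h01 (u : R) : herm (G 0 u) (G 1 u) = C0.
Proof. destruct HG as [_ [H0 [_ [_ [Hz _]]]]]; now apply zeta_eq0. Qed.

Lemma lift_h10 (u : R) : herm (G 1 u) (G 0 u) = C0.
Proof. rewrite herm_conj, lift_h01; apply Cconj_C0. Qed.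

Lemma lift_det (u : R) : det3 (G 0 u) (G 1 u) (G 2 u) = Ci.
Proof. apply HG. Qed.

Lemma lift_det_neq0 (u : R) : det3 (G 0 u) (G 1 u) (G 2 u) <> C0.
Proof. rewrite lift_det; intros E; apply (f_equal Im) in E; simpl in E; lra. Qed.

Lemma lift_h02_h11 (u : R) : herm (G 0 u) (G 2 u) = (- herm (G 1 u) (G 1 u))%cx.
Proof.
  pose proof (derivC_of_constant _ _ _ (lift_herm_deriv 0 1) lift_h01 u) as H; cbv beta in H.
  transitivity ((herm (G 1 u) (G 1 u) + herm (G 0 u) (G 2 u)) - herm (G 1 u) (G 1 u))%cx; [ring|].
  rewrite H; ring.
Qed.

(** With [h = <G1,G1>], which is real, the Gram matrix of the frame is anti-triangular with
    anti-diagonal [-h, h, -h]. Its determinant [-h^3] equals -1 by the normalization, so [h^3 = 1]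
    and [h = 1]. *)
Lemma lift_h11 (u : R) : herm (G 1 u) (G 1 u) = Cone.
Proof.
  pose proof (gram_det (G 0 u) (G 1 u) (G 2 u) (G 0 u) (G 1 u) (G 2 u)) as H.
  rewrite lift_det, lift_h00, lift_h01, lift_h10, (herm_conj (G 0 u) (G 2 u)), lift_h02_h11 in H.
  unfold det3 in H; simpl in H.
  pose proof (herm_self_real (G 1 u)) as Hr.
  set (h := herm (G 1 u) (G 1 u)) in *; destruct h as [a b]; simpl in Hr; subst b.
  apply (f_equal Re) in H; simpl in H; ring_simplify in H.
  assert (Ha : (a - 1) * (a ^ 2 + a + 1) = 0) by lra.
  apply Rmult_integral in Ha as [Ha|Ha]; [|nra].
  C_reals; [lra|reflexivity].
Qed.

Lemma lift_h02 (u : R) : herm (G 0 u) (G 2 u) = (- Cone)%cx.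
Proof. now rewrite lift_h02_h11, lift_h11. Qed.

Lemma lift_h20 (u : R) : herm (G 2 u) (G 0 u) = (- Cone)%cx.
Proof. rewrite herm_conj, lift_h02; C_reals; ring. Qed.

Lemma lift_det013 (u : R) : det3 (G 0 u) (G 1 u) (G 3 u) = C0.
Proof.
  pose proof (derivC_of_constant _ _ _
    (derivC_det3 _ _ _ _ _ _ (lift_deriv 0) (lift_deriv 1) (lift_deriv 2)) lift_det u) as H.
  cbv beta in H; rewrite <- H; unfold det3; ring.
Qed.

(** The mixed Gram determinant of [(G0,G1,G2)] against [(G0,G1,G3)] reduces to [<G0,G3>], and it
    vanishes with [det(G0,G1,G3)]. *)
Lemma lift_h03 (u : R) : herm (G 0 u) (G 3 u) = C0.
Proof.
  pose proof (gram_det (G 0 u) (G 1 u) (G 2 u) (G 0 u) (G 1 u) (G 3 u)) as H.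
  rewrite lift_det013, lift_h00, lift_h01, lift_h10, lift_h20, lift_h11 in H.
  unfold det3 in H; simpl in H.
  transitivity (C0 * C0)%cx; [|ring].
  match type of H with ?a = _ => transitivity a end; [ring|rewrite H; ring].
Qed.

Lemma lift_h12 (u : R) : herm (G 1 u) (G 2 u) = C0.
Proof.
  pose proof (derivC_of_constant _ _ _ (lift_herm_deriv 0 2) lift_h02 u) as H; cbv beta in H.
  rewrite lift_h03 in H; rewrite <- H; ring.
Qed.

Lemma lift_h21 (u : R) : herm (G 2 u) (G 1 u) = C0.
Proof. rewrite herm_conj, lift_h12; apply Cconj_C0. Qed.

Lemma lift_h22 (u : R) : herm (G 2 u) (G 2 u) = RtoC (2 * cr_curvature G u).
Proof.
  apply C_eq; [|apply herm_self_real].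
  change (Re (herm (G 2 u) (G 2 u)) = 2 * (Re (herm (G 2 u) (G 2 u)) / 2)); lra.
Qed.

Lemma lift_h13 (u : R) : herm (G 1 u) (G 3 u) = (- RtoC (2 * cr_curvature G u))%cx.
Proof.
  pose proof (derivC_of_constant _ _ _ (lift_herm_deriv 1 2) lift_h12 u) as H; cbv beta in H.
  rewrite lift_h22 in H.
  transitivity ((RtoC (2 * cr_curvature G u) + herm (G 1 u) (G 3 u)) - RtoC (2 * cr_curvature G u))%cx;
    [ring|rewrite H; ring].
Qed.

(** Differentiating [<G2,G2> = 2k] fixes the real part. The imaginary part is the natural
    parameterization, with a sign from exchanging the arguments. *)
Lemma lift_h23 (k1 : R -> R) :
  (forall u, derivable_pt_lim (cr_curvature G) u (k1 u)) ->
  forall u, herm (G 2 u) (G 3 u) = (RtoC (k1 u) - Ci)%cx.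
Proof.
  intros Hk u.
  assert (Hd : derivC (fun u => RtoC (2 * cr_curvature G u)) (fun u => RtoC (2 * k1 u))).
  { apply derivC_RtoC; intros v; eapply D_val; [apply D_mult; [apply D_const|apply Hk]|cbv beta; ring]. }
  pose proof (derivC_unique _ _ _ _ (lift_herm_deriv 2 2) Hd lift_h22 u) as H; cbv beta in H.
  assert (Hi : Im (herm (G 3 u) (G 2 u)) = 1) by apply HG.
  rewrite (herm_conj (G 2 u) (G 3 u)) in H, Hi.
  set (h := herm (G 2 u) (G 3 u)) in *; clearbody h.
  apply (f_equal Re) in H; simpl in H, Hi; C_reals; lra.
Qed.

(** The difference of the two sides, as a vector, is orthogonal to the frame [G0, G1, G2], hence
    zero by nondegeneracy. *)
Theorem lift_third_derivative (k1 : R -> R) (p : C3 -> C) :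
  (forall u, derivable_pt_lim (cr_curvature G) u (k1 u)) -> coordinate p ->
  forall u, p (G 3 u) =
    ((Ci - RtoC (k1 u)) * p (G 0 u) - RtoC (2 * cr_curvature G u) * p (G 1 u))%cx.
Proof.
  intros Hk Hp u.
  set (r := fun q : C3 -> C =>
    (q (G 3 u) - ((Ci - RtoC (k1 u)) * q (G 0 u) - RtoC (2 * cr_curvature G u) * q (G 1 u)))%cx).
  assert (L : forall x, herm x (mkC3 (r c1) (r c2) (r c3)) =
    (herm x (G 3 u) - ((Ci - RtoC (k1 u)) * herm x (G 0 u)
       - RtoC (2 * cr_curvature G u) * herm x (G 1 u)))%cx)
    by (intros x; unfold r, herm; simpl; ring).
  assert (E : mkC3 (r c1) (r c2) (r c3) = zero3).
  { apply (herm_nondegenerate _ _ _ _ (lift_det_neq0 u)); rewrite L.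
    - rewrite lift_h03, lift_h00, lift_h01; ring.
    - rewrite lift_h13, lift_h10, lift_h11; ring.
    - rewrite (lift_h23 k1 Hk), lift_h20, lift_h21; ring. }
  assert (Er : r p = C0).
  { destruct Hp as [-> | [-> | ->]];
      [exact (f_equal c1 E)|exact (f_equal c2 E)|exact (f_equal c3 E)]. }
  unfold r in Er; transitivity (r p +
    ((Ci - RtoC (k1 u)) * p (G 0 u) - RtoC (2 * cr_curvature G u) * p (G 1 u)))%cx.
  - unfold r; ring.
  - unfold r; rewrite Er; ring.
Qed.

Lemma lift_coordinate_deriv (n : nat) (p : C3 -> C) :
  coordinate p -> derivC (fun u => p (G n u)) (fun u => p (G (S n) u)).
Proof.
  pose proof (has_deriv3_iff _ _ (lift_deriv n)) as [H1 [H2 H3]].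
  intros [-> | [-> | ->]]; assumption.
Qed.

(* A translation acting by scalars c(u) satisfies c^3 = 1 because of the normalization of the
   determinant; hence c' = 0 and the translation acts by c on all derivatives. *)
Lemma lift_translation (T : R) :
  (forall u, exists a, G 0 (u + T) = scale3 a (G 0 u)) ->
  exists c : R -> C,
    (forall u, (c u * c u * c u)%cx = Cone) /\ (forall u, Cnorm2 (c u) = 1) /\
    (forall u p, coordinate p ->
       p (G 0 (u + T)) = (c u * p (G 0 u))%cx /\
       p (G 1 (u + T)) = (c u * p (G 1 u))%cx /\
       p (G 2 (u + T)) = (c u * p (G 2 u))%cx).
Proof.
  intros H.
  (* The hypothesis gives a scalar for each [u] separately, with no regularity. Pairing with [G2],
     where [<G2,G0> = -1], recovers it as a differentiable function. *)
  set (c := fun u => (- herm (G 2 u) (G 0 (u + T)))%cx).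
  set (c' := fun u => (- (herm (G 3 u) (G 0 (u + T)) + herm (G 2 u) (G 1 (u + T))))%cx).
  set (c'' := fun u => (- ((herm (G 4 u) (G 0 (u + T)) + herm (G 3 u) (G 1 (u + T)))
     + (herm (G 3 u) (G 1 (u + T)) + herm (G 2 u) (G 2 (u + T)))))%cx).
  assert (Hsh : forall n, has_deriv3 (fun u => G n (u + T)) (fun u => G (S n) (u + T))).
  { intros n u; pose proof (has_deriv3_iff _ _ (lift_deriv n)) as [H1 [H2 H3]].
    destruct (derivC_shift _ _ T H1 u), (derivC_shift _ _ T H2 u), (derivC_shift _ _ T H3 u).
    repeat split; assumption. }
  assert (Hopp : forall f f', derivC f f' -> derivC (fun u => - f u)%cx (fun u => - f' u)%cx).
  { intros f f' Hf u; destruct (Hf u); split; simpl; apply D_opp; assumption. }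
  assert (Dc : derivC c c') by (apply Hopp, derivC_herm; [apply lift_deriv|apply Hsh]).
  assert (Dc' : derivC c' c'').
  { apply Hopp, derivC_add; apply derivC_herm; try apply lift_deriv; apply Hsh. }
  assert (E0 : forall p, coordinate p -> forall u, p (G 0 (u + T)) = (c u * p (G 0 u))%cx).
  { intros p Hp u; destruct (H u) as [a Ha].
    assert (Ea : a = c u).
    { unfold c; rewrite Ha; transitivity (- (a * herm (G 2 u) (G 0 u)))%cx.
      - rewrite lift_h20; ring.
      - unfold herm, scale3; simpl; ring. }
    rewrite Ha, <- Ea; destruct Hp as [-> | [-> | ->]]; reflexivity. }
  assert (E1 : forall p, coordinate p -> forall u,
    p (G 1 (u + T)) = (c' u * p (G 0 u) + c u * p (G 1 u))%cx).
  { intros p Hp; refine (derivC_unique _ _ _ _ _ _ (E0 p Hp)).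
    - apply (derivC_shift (fun u => p (G 0 u)) (fun u => p (G 1 u))); now apply lift_coordinate_deriv.
    - apply derivC_mul; [exact Dc|now apply lift_coordinate_deriv]. }
  assert (E2 : forall p, coordinate p -> forall u,
    p (G 2 (u + T)) =
      (c'' u * p (G 0 u) + c' u * p (G 1 u) + (c' u * p (G 1 u) + c u * p (G 2 u)))%cx).
  { intros p Hp; refine (derivC_unique _ _ _ _ _ _ (E1 p Hp)).
    - apply (derivC_shift (fun u => p (G 1 u)) (fun u => p (G 2 u))); now apply lift_coordinate_deriv.
    - apply derivC_add; apply derivC_mul; try assumption; now apply lift_coordinate_deriv. }
  assert (K1 : coordinate c1) by (left; reflexivity).
  assert (K2 : coordinate c2) by (right; left; reflexivity).
  assert (K3 : coordinate c3) by (right; right; reflexivity).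
  assert (Hc3 : forall u, (c u * c u * c u)%cx = Cone).
  { intros u.
    assert (Ed : (c u * c u * c u * Ci)%cx = Ci).
    { rewrite <- (lift_det (u + T)) at 2; rewrite <- (lift_det u) at 1; unfold det3.
      rewrite !(E0 _ K1), !(E0 _ K2), !(E0 _ K3), !(E1 _ K1), !(E1 _ K2), !(E1 _ K3),
        !(E2 _ K1), !(E2 _ K2), !(E2 _ K3); ring. }
    transitivity (- (c u * c u * c u * Ci * Ci))%cx; [ring [Ci_sq]|rewrite Ed; ring [Ci_sq]]. }
  assert (Hc' : forall u, c' u = C0).
  { intros u.
    pose proof (derivC_of_constant _ _ _
      (derivC_mul _ _ _ _ (derivC_mul _ _ _ _ Dc Dc) Dc) Hc3 u) as E; cbv beta in E.
    assert (E3 : (RtoC 3 * c' u)%cx = C0).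
    { transitivity (c u * ((c' u * c u + c u * c' u) * c u + c u * c u * c' u))%cx.
      - transitivity (RtoC 3 * (c u * c u * c u) * c' u)%cx; [rewrite Hc3; ring|].
        replace (RtoC 3) with (Cone + Cone + Cone)%cx by (C_reals; ring); ring.
      - rewrite E; ring. }
    destruct (Cmul_integral _ _ E3) as [E4|E4]; [|exact E4].
    apply (f_equal Re) in E4; simpl in E4; lra. }
  assert (Hc'' : forall u, c'' u = C0) by exact (derivC_of_constant _ _ _ Dc' Hc').
  exists c; split; [exact Hc3|split].
  - intros u.
    assert (E : Cnorm2 (c u) * Cnorm2 (c u) * Cnorm2 (c u) = 1).
    { rewrite <- !Cnorm2_mul, Hc3; unfold Cnorm2; simpl; ring. }
    pose proof (Cnorm2_ge0 (c u)) as Hn.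
    assert (E' : (Cnorm2 (c u) - 1) * (Cnorm2 (c u) ^ 2 + Cnorm2 (c u) + 1) = 0) by lra.
    apply Rmult_integral in E' as [E'|E']; [lra|nra].
  - intros u p Hp; rewrite (E0 p Hp), (E1 p Hp), (E2 p Hp), Hc', Hc''.
    repeat split; ring.
Qed.

Lemma cr_curvature_translation (T : R) (c : C) (u : R) :
  Cnorm2 c = 1 -> (forall p, coordinate p -> p (G 2 (u + T)) = (c * p (G 2 u))%cx) ->
  cr_curvature G (u + T) = cr_curvature G u.
Proof.
  intros Hc E; unfold cr_curvature.
  assert (Es : G 2 (u + T) = scale3 c (G 2 u)).
  { apply C3_eq; simpl; apply E; unfold coordinate; auto. }
  rewrite Es; replace (herm (scale3 c (G 2 u)) (scale3 c (G 2 u)))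
    with (RtoC (Cnorm2 c) * herm (G 2 u) (G 2 u))%cx.
  - rewrite Hc; simpl; lra.
  - unfold herm, scale3, Cnorm2; C_reals; ring.
Qed.

(** Replacing the middle vector of the frame by the combination multiplies the determinant by [b].
    Only [b] is extracted, since in [eigenfunction] the coefficient of [z1] has imaginary part 1. *)
Lemma coordinate_wronskian (u : R) (a b c : C) :
  (forall p, coordinate p -> (a * p (G 0 u) + b * p (G 1 u) + c * p (G 2 u))%cx = C0) ->
  b = C0.
Proof.
  intros H.
  assert (E : (b * det3 (G 0 u) (G 1 u) (G 2 u))%cx = C0).
  { transitivity (det3 (G 0 u)
      (mkC3 (a * c1 (G 0 u) + b * c1 (G 1 u) + c * c1 (G 2 u))
            (a * c2 (G 0 u) + b * c2 (G 1 u) + c * c2 (G 2 u))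
            (a * c3 (G 0 u) + b * c3 (G 1 u) + c * c3 (G 2 u)))%cx (G 2 u)).
    - unfold det3; simpl; ring.
    - rewrite !H by (unfold coordinate; auto); unfold det3; simpl; ring. }
  destruct (Cmul_integral _ _ E) as [?|E']; [assumption|destruct (lift_det_neq0 u E')].
Qed.

End NormalizedLift.

(** * Eigenfunctions of the commuting second-order operator *)

Definition shifted_curvature (k : R -> R) (mu : C) (u : R) : C := (RtoC (2 / 3 * k u) + mu)%cx.

(* With A = D^2 + (4/3) k, which preserves the solutions of z''' = (i - k') z - 2 k z' and has
   characteristic polynomial chi there, this is (A^2 + mu A + mu^2 - c/3) z, the projection
   of z to the mu-eigenspace up to a factor when chi mu = 0. *)
Definition eigenfunction (k k1 : R -> R) (mu : C) (z0 z1 z2 : R -> C) (u : R) : C :=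
  let g := shifted_curvature k mu u in
  (g * g * z0 u + (Ci - RtoC (k1 u / 3)) * z1 u + g * z2 u)%cx.

Definition chi (c d : R) (mu : C) : C :=
  (mu * mu * mu - RtoC (c / 3) * mu + RtoC ((d + 9) / 9))%cx.

Definition cis (x : R) : C := mkC (cos x) (sin x).

Lemma cis_add (x y : R) : cis (x + y) = (cis x * cis y)%cx.
Proof. C_reals; [rewrite cos_plus|rewrite sin_plus]; ring. Qed.

Lemma cis_opp_l (x : R) : (cis (- x) * cis x)%cx = Cone.
Proof.
  rewrite <- cis_add; C_reals; rewrite Rplus_opp_l; [apply cos_0|apply sin_0].
Qed.

Lemma nonneg_derivative_nondecreasing (f f' : R -> R) :
  (forall u, derivable_pt_lim f u (f' u)) -> (forall u, 0 <= f' u) ->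
  forall u v, u <= v -> f u <= f v.
Proof.
  intros H Hp u v [Huv| ->]; [|lra].
  destruct (MVT_cor2 f f' u v Huv) as [x [E _]]; [intros; apply H|].
  specialize (Hp x); nra.
Qed.

Lemma D_Cnorm2 (f f' : R -> C) (u : R) :
  derivC f f' ->
  derivable_pt_lim (fun t => Cnorm2 (f t)) u (2 * (Re (f u) * Re (f' u) + Im (f u) * Im (f' u))).
Proof.
  intros H; destruct (H u); unfold Cnorm2; eapply D_val.
  - apply D_plus; apply D_pow; eassumption.
  - simpl; ring.
Qed.

(** The real part suffices, because [1 - cos x = 2 sin^2 (x/2)]. *)
Lemma cis_eq1 (x : R) : cis x = Cone -> exists z : Z, x = 2 * IZR z * PI.
Proof.
  intros E; apply (f_equal Re) in E; simpl in E.
  assert (Hs : sin (x / 2) = 0).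
  { replace x with (2 * (x / 2)) in E by field; rewrite cos_2a_sin in E.
    assert (E' : sin (x / 2) * sin (x / 2) = 0) by lra.
    apply Rmult_integral in E'; tauto. }
  apply sin_eq_0_0 in Hs as [z Hz]; exists z; lra.
Qed.

Lemma cis_2PI_IZR (z : Z) : cis (2 * PI * IZR z) = Cone.
Proof.
  assert (Hs : sin (IZR z * PI) = 0) by (apply sin_eq_0_1; exists z; reflexivity).
  replace (2 * PI * IZR z) with (2 * (IZR z * PI)) by ring.
  C_reals; [rewrite cos_2a_sin|rewrite sin_2a]; rewrite Hs; ring.
Qed.

(** This is the real part of [conj y] times the relation multiplied by [conj g]. The summand
    [C0 * z] keeps the shape of [eigenfunction_eq] once [chi] has been rewritten to zero. *)
Lemma eigen_relation_norm (g y y' z : C) (p : R) :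
  (g * y' = (RtoC p + Ci) * y + C0 * z)%cx ->
  Cnorm2 g * (Re y * Re y' + Im y * Im y') = (Re g * p + Im g) * Cnorm2 y.
Proof.
  intros E; pose proof (f_equal Re E) as Er; pose proof (f_equal Im E) as Ei.
  destruct g as [a b], y as [y x], y' as [y' x']; unfold Cnorm2; simpl in *.
  transitivity ((y * a - x * b) * (a * y' - b * x') + (y * b + x * a) * (a * x' + b * y')); [ring|].
  rewrite Er, Ei; ring.
Qed.

Lemma real_eigen_relation (g p : R) (y y' z : C) :
  (RtoC g * y' = (RtoC p + Ci) * y + C0 * z)%cx ->
  g * Re y' = p * Re y - Im y /\ g * Im y' = p * Im y + Re y.
Proof.
  intros E; pose proof (f_equal Re E) as Er; pose proof (f_equal Im E) as Ei.
  destruct y, y'; simpl in *; split; lra.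
Qed.

Lemma real_generalized_relation (g p : R) (z z' y' : C) :
  (RtoC g * z' + y' = (RtoC p + Ci) * z)%cx ->
  g * Re z' = p * Re z - Im z - Re y' /\ g * Im z' = p * Im z + Re z - Im y'.
Proof.
  intros E; pose proof (f_equal Re E) as Er; pose proof (f_equal Im E) as Ei.
  destruct z, z', y'; simpl in *; split; lra.
Qed.

Lemma RtoC_mult (x y : R) : RtoC (x * y) = (RtoC x * RtoC y)%cx.
Proof. C_reals; ring. Qed.

Section Eigenfunctions.

Variables (k k1 k2 : R -> R) (c d : R) (z0 z1 z2 : R -> C).
Hypothesis Hk : forall u, derivable_pt_lim k u (k1 u).
Hypothesis Hk1 : forall u, derivable_pt_lim k1 u (k2 u).
Hypothesis Hk2 : forall u, k2 u = c - 4 * k u ^ 2.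
Hypothesis Hen : forall u, k1 u ^ 2 = 2 * c * k u - 8 / 3 * k u ^ 3 + d.
Hypothesis Hz0 : derivC z0 z1.
Hypothesis Hz1 : derivC z1 z2.
Hypothesis Hz2 :
  derivC z2 (fun u => (Ci - RtoC (k1 u)) * z0 u - RtoC (2 * k u) * z1 u)%cx.

(** The Taylor expansion of [chi] about [-2k/3] in powers of [g]: the two first integrals [c] and
    [d] turn its coefficients into expressions in [k], [k'], [k'']. *)
Lemma chi_shifted (mu : C) (u : R) :
  let g := shifted_curvature k mu u in
  (g * (g * g - RtoC (k2 u / 3) - RtoC (2 * k u) * g) + RtoC (1 + k1 u ^ 2 / 9))%cx = chi c d mu.
Proof.
  unfold shifted_curvature, chi; cbv zeta; rewrite Hk2, Hen; destruct mu as [a b].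
  C_reals; field.
Qed.

(** Where [g = 0], the expansion leaves [chi mu = 1 + k'^2/9], which is positive. *)
Lemma shifted_curvature_neq0 (mu : C) (u : R) :
  chi c d mu = C0 -> shifted_curvature k mu u <> C0.
Proof.
  intros Hc Hg; pose proof (chi_shifted mu u) as H; cbv zeta in H; rewrite Hg, Hc in H.
  apply (f_equal Re) in H; simpl in H; nra.
Qed.

Lemma shifted_curvature_deriv (mu : C) :
  derivC (shifted_curvature k mu) (fun u => RtoC (2 / 3 * k1 u)).
Proof.
  eapply derivC_ext.
  - apply derivC_add; [apply derivC_RtoC with (f' := fun u => 2 / 3 * k1 u)|apply derivC_const].
    intros v; eapply D_val; [apply D_mult; [apply D_const|apply Hk]|cbv beta; ring].
  - intros u; C_reals; ring.
Qed.

Definition eigenfunction' (mu : C) (u : R) : C :=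
  let g := shifted_curvature k mu u in
  (g * (Ci + RtoC (k1 u / 3)) * z0 u + (g * g - RtoC (k2 u / 3) - RtoC (2 * k u) * g) * z1 u
   + (Ci + RtoC (k1 u / 3)) * z2 u)%cx.

Lemma eigenfunction_deriv (mu : C) :
  derivC (eigenfunction k k1 mu z0 z1 z2) (eigenfunction' mu).
Proof.
  pose proof (shifted_curvature_deriv mu) as Hg.
  assert (Hk1' : derivC (fun u => RtoC (k1 u / 3)) (fun u => RtoC (k2 u / 3))).
  { apply derivC_RtoC; intros u; unfold Rdiv.
    eapply D_val; [apply D_mult; [apply Hk1|apply D_const]|cbv beta; ring]. }
  unfold eigenfunction; eapply derivC_ext.
  - apply derivC_add; [apply derivC_add|]; apply derivC_mul; try eassumption.
    + apply derivC_mul; exact Hg.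
    + apply derivC_sub; [apply derivC_const|exact Hk1'].
  - intros u; cbv beta; unfold eigenfunction'; cbv zeta.
    replace (RtoC (2 / 3 * k1 u)) with (RtoC (k1 u / 3) + RtoC (k1 u / 3))%cx by (C_reals; field).
    replace (RtoC (k1 u)) with (RtoC (k1 u / 3) + RtoC (k1 u / 3) + RtoC (k1 u / 3))%cx
      by (C_reals; field).
    ring.
Qed.

(** The coefficients of [z0] and [z2] agree on both sides. For [z1],
    [(k'/3 + i)(i - k'/3) = -(1 + k'^2/9)], and [chi_shifted] accounts for the rest. Keeping the
    defect [chi mu * z1] shows what happens at a double root, where its derivative in [mu] vanishes
    as well. *)
Lemma eigenfunction_eq (mu : C) (u : R) :
  (shifted_curvature k mu u * eigenfunction' mu u)%cx =
  ((RtoC (k1 u / 3) + Ci) * eigenfunction k k1 mu z0 z1 z2 u + chi c d mu * z1 u)%cx.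
Proof.
  rewrite <- (chi_shifted mu u); unfold eigenfunction, eigenfunction'; cbv zeta.
  replace (RtoC (1 + k1 u ^ 2 / 9)) with (Cone + RtoC (k1 u / 3) * RtoC (k1 u / 3))%cx
    by (C_reals; field).
  ring [Ci_sq].
Qed.

(* |Y|^4 / |g|^2 has logarithmic derivative 4 Im mu / |g|^2. *)
Lemma nonreal_eigenfunction_not_periodic (mu : C) (T : R) :
  chi c d mu = C0 -> 0 < Im mu -> 0 < T -> k T = k 0 ->
  Cnorm2 (eigenfunction k k1 mu z0 z1 z2 T) = Cnorm2 (eigenfunction k k1 mu z0 z1 z2 0) ->
  eigenfunction k k1 mu z0 z1 z2 0 = C0.
Proof.
  intros Hc Hm HT HkT HN.
  set (Y := eigenfunction k k1 mu z0 z1 z2) in *.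
  set (g := shifted_curvature k mu).
  set (M := fun u => Cnorm2 (Y u) ^ 2 / Cnorm2 (g u)).
  assert (Hg : forall u, 0 < Cnorm2 (g u)).
  { intros u; now apply Cnorm2_pos, shifted_curvature_neq0. }
  set (M' := fun u => 4 * Im mu / Cnorm2 (g u) * M u).
  assert (HM : forall u, derivable_pt_lim M u (M' u)).
  { intros u; pose proof (Hg u) as Hgu; eapply D_val.
    - apply D_div; [apply D_pow, D_Cnorm2, eigenfunction_deriv|
        apply D_Cnorm2, shifted_curvature_deriv|lra].
    - fold Y g; pose proof (eigenfunction_eq mu u) as E; fold Y g in E; rewrite Hc in E.
      assert (Eg : Im (g u) = Im mu) by (unfold g, shifted_curvature; simpl; ring).
      assert (Egr : Re (g u) = 2 / 3 * k u + Re mu) by reflexivity.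
      unfold M', M.
      set (N' := Re (Y u) * Re (eigenfunction' mu u) + Im (Y u) * Im (eigenfunction' mu u)).
      assert (EN : Cnorm2 (g u) * N' = (Re (g u) * (k1 u / 3) + Im mu) * Cnorm2 (Y u)).
      { rewrite <- Eg; exact (eigen_relation_norm _ _ _ _ _ E). }
      set (S := Cnorm2 (g u)) in *; set (N := Cnorm2 (Y u)) in *.
      simpl; apply (Rmult_eq_reg_r (S ^ 2)); [|nra].
      unfold Rdiv at 1; rewrite Rmult_assoc, Rinv_l by nra.
      transitivity (4 * N * (S * N') - N ^ 2 * (4 / 3 * Re (g u) * k1 u)); [rewrite Egr; field|].
      rewrite EN; field; lra. }
  assert (HM0 : forall u, 0 <= M u).
  { intros u; unfold M; pose proof (Rinv_0_lt_compat _ (Hg u)); unfold Rdiv.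
    pose proof (pow2_ge_0 (Cnorm2 (Y u))); nra. }
  assert (Hpos : forall u, 0 < 4 * Im mu / Cnorm2 (g u)).
  { intros u; pose proof (Rinv_0_lt_compat _ (Hg u)); unfold Rdiv; nra. }
  assert (HMinc : forall u v, u <= v -> M u <= M v).
  { apply (nonneg_derivative_nondecreasing M M' HM); intros u; unfold M'.
    pose proof (HM0 u); pose proof (Hpos u); nra. }
  assert (HMT : M T = M 0).
  { unfold M; rewrite HN; unfold g, shifted_curvature; rewrite HkT; reflexivity. }
  (* Working with [M] rather than its logarithm allows zeros of [Y]: equal values at 0 and [T] force
     [M x = 0] at some intermediate [x], and monotonicity with [M >= 0] carries the zero back to
     0. *)
  destruct (MVT_cor2 M M' 0 T HT) as [x [E Hx]]; [intros; apply HM|].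
  rewrite HMT in E; unfold M' in E.
  assert (HMx : M x = 0).
  { assert (E' : 4 * Im mu / Cnorm2 (g x) * T * M x = 0) by lra.
    apply Rmult_integral in E' as [E'|E']; [pose proof (Hpos x); nra|exact E']. }
  assert (HM00 : M 0 = 0) by (pose proof (HMinc 0 x ltac:(lra)); pose proof (HM0 0); lra).
  unfold M, Rdiv in HM00; apply Rmult_integral in HM00 as [H|H].
  - apply Cnorm2_eq0; nra.
  - pose proof (Rinv_0_lt_compat _ (Hg 0)); lra.
Qed.

Section RealEigenvalue.

Variable mu : R.
Hypothesis Hchi : chi c d (RtoC mu) = C0.

Let g (u : R) : R := 2 / 3 * k u + mu.
Let Y := eigenfunction k k1 (RtoC mu) z0 z1 z2.
Let Y' := eigenfunction' (RtoC mu).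

Lemma shifted_curvature_real (u : R) : shifted_curvature k (RtoC mu) u = RtoC (g u).
Proof. unfold shifted_curvature, g; C_reals; ring. Qed.

Lemma real_shift_neq0 (u : R) : g u <> 0.
Proof.
  intros E; apply (shifted_curvature_neq0 (RtoC mu) u Hchi); rewrite shifted_curvature_real, E.
  reflexivity.
Qed.

Lemma real_shift_deriv (u : R) : derivable_pt_lim g u (2 / 3 * k1 u).
Proof.
  unfold g; eapply D_val;
    [apply D_plus; [apply D_mult; [apply D_const|apply Hk]|apply D_const]|cbv beta; ring].
Qed.

Lemma real_eigenfunction_re (u : R) : g u * Re (Y' u) = k1 u / 3 * Re (Y u) - Im (Y u).
Proof.
  pose proof (eigenfunction_eq (RtoC mu) u) as E; rewrite Hchi, shifted_curvature_real in E.
  exact (proj1 (real_eigen_relation _ _ _ _ _ E)).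
Qed.

Lemma real_eigenfunction_im (u : R) : g u * Im (Y' u) = k1 u / 3 * Im (Y u) + Re (Y u).
Proof.
  pose proof (eigenfunction_eq (RtoC mu) u) as E; rewrite Hchi, shifted_curvature_real in E.
  exact (proj2 (real_eigen_relation _ _ _ _ _ E)).
Qed.

(** The quotient [|Y|^2 / g] is constant, since the eigenvalue relation gives
    [(|Y|^2)' = 2k'/(3g) |Y|^2] and [g' = 2k'/3]. *)
Lemma real_eigenfunction_norm_neq0 (u : R) : Y 0 <> C0 -> Cnorm2 (Y u) <> 0.
Proof.
  intros H0.
  assert (D : forall u, derivable_pt_lim (fun t => Cnorm2 (Y t) / g t) u 0).
  { intros v; pose proof (real_shift_neq0 v) as Hg; eapply D_val.
    - apply D_div; [apply D_Cnorm2, eigenfunction_deriv|apply real_shift_deriv|exact Hg].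
    - fold Y Y'; unfold Rdiv at 1; apply Rmult_eq_0_compat_r.
      transitivity (2 * (Re (Y v) * (g v * Re (Y' v)) + Im (Y v) * (g v * Im (Y' v)))
                    - Cnorm2 (Y v) * (2 / 3 * k1 v)); [ring|].
      rewrite real_eigenfunction_re, real_eigenfunction_im; unfold Cnorm2; field. }
  pose proof (derivative_zero_constant _ D 0 u) as E; cbv beta in E.
  intros Hu; rewrite Hu in E; pose proof (Cnorm2_pos _ H0).
  pose proof (Rinv_neq_0_compat _ (real_shift_neq0 0)).
  assert (E' : Cnorm2 (Y 0) * / g 0 = 0) by (unfold Rdiv in E; lra).
  apply Rmult_integral in E' as [E'|E']; lra.
Qed.

(* At a double root the mu-derivative of Y is a generalized eigenfunction Z, and
   Im (Z / Y) has derivative - 1 / g^2. *)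
Lemma double_eigenvalue_not_periodic (T : R) (a : C) :
  3 * mu ^ 2 = c / 3 -> 0 < T -> k T = k 0 -> k1 T = k1 0 ->
  Cnorm2 a = 1 ->
  z0 T = (a * z0 0)%cx -> z1 T = (a * z1 0)%cx -> z2 T = (a * z2 0)%cx ->
  Y 0 = C0.
Proof.
  intros Hdbl HT HkT Hk1T Ha E0 E1 E2.
  destruct (excluded_middle_informative (Y 0 = C0)) as [?|HY0]; [assumption|exfalso].
  assert (HN : forall u, Cnorm2 (Y u) <> 0) by (intros; now apply real_eigenfunction_norm_neq0).
  set (Z := fun u => (RtoC (2 * g u) * z0 u + z2 u)%cx).
  set (Z' := fun u => (RtoC (4 / 3 * k1 u) * z0 u + RtoC (2 * g u) * z1 u
     + ((Ci - RtoC (k1 u)) * z0 u - RtoC (2 * k u) * z1 u))%cx).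
  assert (DZ : derivC Z Z').
  { apply derivC_add; [|exact Hz2].
    apply derivC_mul; [|exact Hz0].
    apply derivC_RtoC; intros u; eapply D_val;
      [apply D_mult; [apply D_const|apply real_shift_deriv]|cbv beta; field]. }
  (* The derivative of [eigenfunction_eq] in [mu]; the defect contributes
     [chi'(mu) z1 = (3 mu^2 - c/3) z1 = 0]. *)
  assert (EZ : forall u, (RtoC (g u) * Z' u + Y' u)%cx = ((RtoC (k1 u / 3) + Ci) * Z u)%cx).
  { intros u; unfold Z', Y', eigenfunction', Z; cbv zeta; rewrite shifted_curvature_real.
    rewrite Hk2; replace c with (9 * mu ^ 2) by lra; unfold g; C_reals; field. }
  set (q := fun u => Im (Z u) * Re (Y u) - Re (Z u) * Im (Y u)).
  set (r := fun u => - (q u / Cnorm2 (Y u))).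
  assert (Dr : forall u, derivable_pt_lim r u (/ (g u) ^ 2)).
  { intros u; pose proof (real_shift_neq0 u) as Hg; pose proof (HN u) as Hu.
    destruct (DZ u) as [DZr DZi]; destruct (eigenfunction_deriv (RtoC mu) u) as [DYr DYi].
    fold Y Y' in DYr, DYi.
    eapply D_val.
    - apply D_opp, D_div; [|apply D_Cnorm2, eigenfunction_deriv|exact Hu].
      apply D_minus; apply D_mult; eassumption.
    - fold Y Y'; cbv beta.
      pose proof (real_eigenfunction_re u) as Er; pose proof (real_eigenfunction_im u) as Ei.
      destruct (real_generalized_relation _ _ _ _ _ (EZ u)) as [Fr Fi].
      unfold q, Cnorm2 in *.
      set (G := g u) in *.
      set (y := Re (Y u)) in *; set (x := Im (Y u)) in *.
      set (y' := Re (Y' u)) in *; set (x' := Im (Y' u)) in *.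
      set (p := Re (Z u)) in *; set (s := Im (Z u)) in *.
      set (p' := Re (Z' u)) in *; set (s' := Im (Z' u)) in *.
      clearbody G y x y' x' p s p' s'.
      assert (Ey : y' = (k1 u / 3 * y - x) / G) by (rewrite <- Er; field; exact Hg).
      assert (Ex : x' = (k1 u / 3 * x + y) / G) by (rewrite <- Ei; field; exact Hg).
      assert (Ep : p' = (k1 u / 3 * p - s - y') / G).
      { rewrite <- Fr; field; exact Hg. }
      assert (Es : s' = (k1 u / 3 * s + p - x') / G).
      { rewrite <- Fi; field; exact Hg. }
      rewrite Ep, Es, Ey, Ex; field; split; [exact Hg|exact Hu]. }
  assert (Hr : r 0 < r T).
  { apply (derivative_pos_increasing r _ Dr); [|exact HT].
    intros u; apply Rinv_0_lt_compat; pose proof (real_shift_neq0 u); nra. }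
  assert (EgT : g T = g 0) by (unfold g; now rewrite HkT).
  assert (EYT : Y T = (a * Y 0)%cx).
  { unfold Y, eigenfunction; rewrite !shifted_curvature_real, EgT, Hk1T, E0, E1, E2; ring. }
  assert (EZT : Z T = (a * Z 0)%cx) by (unfold Z; rewrite EgT, E0, E2; ring).
  assert (Hq : q T = q 0).
  { transitivity (Cnorm2 a * q 0); [|rewrite Ha; ring].
    unfold q; rewrite EYT, EZT; unfold Cnorm2; simpl; ring. }
  assert (ErT : r T = r 0).
  { unfold r; rewrite Hq, EYT, Cnorm2_mul, Ha; f_equal; f_equal; ring. }
  lra.
Qed.

(* The eigenfunction is |g|^(1/2) e^(i theta) times a constant when theta' = 1/g. *)
Lemma real_eigenfunction_translation (theta : R -> R) (T Delta : R) :
  (forall u, derivable_pt_lim theta u (/ (2 / 3 * k u + mu))) ->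
  (forall u, k (u + T) = k u) ->
  (forall u, theta (u + T) = theta u + Delta) ->
  forall u, Y (u + T) = (cis Delta * Y u)%cx.
Proof.
  intros Hth HkT HthT u.
  (* This is [|g|^(-1/2)], written through [g^2] because [g] may be negative. The product of [r],
     [e^(-i theta)] and [Y] is then constant. *)
  set (r := fun u => exp (- (/ 4 * ln (g u ^ 2)))).
  assert (Dr : forall u, derivable_pt_lim r u (- (k1 u / (3 * g u)) * r u)).
  { intros v; pose proof (real_shift_neq0 v) as Hg; eapply D_val.
    - apply (D_comp exp (fun t => - (/ 4 * ln (g t ^ 2)))).
      + apply D_opp, D_mult; [apply D_const|].
        apply (D_comp ln (fun t => g t ^ 2)); [apply D_pow, real_shift_deriv|].
        apply derivable_pt_lim_ln; nra.
      + apply derivable_pt_lim_exp.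
    - unfold r; simpl; field; exact Hg. }
  set (e := fun u => cis (- theta u)).
  assert (De : derivC e (fun u => - (RtoC (/ g u) * Ci * e u))%cx).
  { intros v; split; unfold e; simpl; eapply D_val.
    - apply (D_comp cos (fun t => - theta t)); [apply D_opp, Hth|apply derivable_pt_lim_cos].
    - fold (g v); ring.
    - apply (D_comp sin (fun t => - theta t)); [apply D_opp, Hth|apply derivable_pt_lim_sin].
    - fold (g v); ring. }
  assert (DW : derivC (fun u => RtoC (r u) * (e u * Y u))%cx (fun _ => C0)).
  { eapply derivC_ext.
    - apply derivC_mul; [apply derivC_RtoC, Dr|].
      apply derivC_mul; [exact De|apply eigenfunction_deriv].
    - intros v; pose proof (real_shift_neq0 v) as Hg; cbv beta; fold Y Y'.
      assert (EY : Y' v = (RtoC (/ g v) * (RtoC (k1 v / 3) + Ci) * Y v)%cx).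
      { pose proof (eigenfunction_eq (RtoC mu) v) as E.
        rewrite Hchi, shifted_curvature_real in E; fold Y Y' in E.
        transitivity (RtoC (/ g v) * (RtoC (g v) * Y' v))%cx; [|rewrite E; ring].
        transitivity (RtoC (/ g v * g v) * Y' v)%cx; [|rewrite RtoC_mult; ring].
        rewrite Rinv_l by exact Hg; change (RtoC 1) with Cone; ring. }
      rewrite EY.
      replace (RtoC (- (k1 v / (3 * g v)) * r v))
        with (- (RtoC (/ g v) * RtoC (k1 v / 3) * RtoC (r v)))%cx by (C_reals; field; exact Hg).
      ring. }
  assert (EW : (RtoC (r (u + T)%R) * (e (u + T)%R * Y (u + T)%R) = RtoC (r u) * (e u * Y u))%cx).
  { apply C_eq.
    - apply (derivative_zero_constant (fun u => Re (RtoC (r u) * (e u * Y u))%cx)); apply DW.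
    - apply (derivative_zero_constant (fun u => Im (RtoC (r u) * (e u * Y u))%cx)); apply DW. }
  assert (ErT : r (u + T) = r u) by (unfold r, g; now rewrite HkT).
  assert (Hr : RtoC (r u) <> C0).
  { intros E; apply (f_equal Re) in E; simpl in E; pose proof (exp_pos (- (/ 4 * ln (g u ^ 2)))).
    unfold r in E; lra. }
  rewrite ErT in EW.
  assert (E : (e (u + T)%R * Y (u + T)%R - e u * Y u)%cx = C0).
  { destruct (Cmul_integral (RtoC (r u)) (e (u + T)%R * Y (u + T)%R - e u * Y u)%cx) as [?|?];
      [|contradiction|assumption].
    transitivity (RtoC (r u) * (e (u + T)%R * Y (u + T)%R) - RtoC (r u) * (e u * Y u))%cx;
      [ring|rewrite EW; ring]. }
  transitivity (cis (theta (u + T)%R) * (e (u + T)%R * Y (u + T)%R - e u * Y u)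
                + cis (theta (u + T)%R) * e u * Y u)%cx.
  - transitivity (e (u + T)%R * cis (theta (u + T)%R) * Y (u + T)%R)%cx; [|ring].
    unfold e; rewrite cis_opp_l; ring.
  - rewrite E, HthT, cis_add; transitivity (cis Delta * (e u * cis (theta u)) * Y u)%cx; [ring|].
    unfold e; rewrite cis_opp_l; ring.
Qed.

End RealEigenvalue.

End Eigenfunctions.

(** * Elliptic integrals and the Jacobi amplitude *)

(** The value chosen by [epsilon] is the integral for some integrability proof, and [RInt_Reals]
    identifies it whichever proof that is. *)
Lemma Rint_RInt (f : R -> R) (a b : R) : ex_RInt f a b -> Rint f a b = RInt f a b.
Proof.
  intros H; unfold Rint.
  destruct (epsilon_spec (inhabits 0)
    (fun I => exists pr : Riemann_integrable f a b, RiemannInt pr = I)) as [pr E].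
  - exists (RiemannInt (ex_RInt_Reals_0 _ _ _ H)); eexists; reflexivity.
  - rewrite <- E; symmetry; apply RInt_Reals.
Qed.

Lemma continuity_ex_RInt (f : R -> R) (a b : R) : continuity f -> ex_RInt f a b.
Proof.
  intros H; apply (ex_RInt_continuous (V := R_CompleteNormedModule)); intros z _.
  apply continuity_pt_filterlim, H.
Qed.

Lemma Rint_deriv (f : R -> R) (x : R) :
  continuity f -> derivable_pt_lim (fun y => Rint f 0 y) x (f x).
Proof.
  intros H.
  apply (derivable_pt_lim_ext (fun y => RInt f 0 y)).
  { intros y; symmetry; apply Rint_RInt, continuity_ex_RInt, H. }
  apply is_derive_Reals, (is_derive_RInt (V := R_CompleteNormedModule)) with (a := 0).
  - apply filter_forall; intros y.
    apply (RInt_correct (V := R_CompleteNormedModule)), continuity_ex_RInt, H.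
  - apply continuity_pt_filterlim, H.
Qed.

Lemma Rint_refl (f : R -> R) (a : R) : Rint f a a = 0.
Proof.
  rewrite Rint_RInt; [exact (RInt_point (V := R_CompleteNormedModule) a f)|apply ex_RInt_point].
Qed.

(** In place of a change of variables, with [F] the primitive of [f]: [F(t + PI) - F(t)] and
    [F(t) + F(PI - t)] have zero derivative, and are evaluated at 0 and [PI / 2]. *)
Lemma Rint_half_turn (f : R -> R) (x : R) :
  continuity f -> (forall t, f (t + PI) = f t) -> (forall t, f (PI - t) = f t) ->
  Rint f 0 (x + PI) = Rint f 0 x + 2 * Rint f 0 (PI / 2).
Proof.
  intros Hc Hp Hs.
  assert (D1 : forall u, derivable_pt_lim (fun t => Rint f 0 (t + PI) - Rint f 0 t) u 0).
  { intros u; eapply D_val.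
    - apply D_minus; [apply (D_shift (fun t => Rint f 0 t))|]; apply Rint_deriv, Hc.
    - cbv beta; rewrite Hp; ring. }
  assert (D2 : forall u, derivable_pt_lim (fun t => Rint f 0 t + Rint f 0 (PI - t)) u 0).
  { intros u; eapply D_val.
    - apply D_plus; [apply Rint_deriv, Hc|].
      apply (D_comp (fun t => Rint f 0 t) (fun t => PI - t)); [|apply Rint_deriv, Hc].
      apply D_minus; [apply D_const|apply D_id].
    - cbv beta; rewrite Hs; ring. }
  pose proof (derivative_zero_constant _ D1 x 0) as E1; cbv beta in E1.
  pose proof (derivative_zero_constant _ D2 0 (PI / 2)) as E2; cbv beta in E2.
  replace (0 + PI) with PI in E1 by ring; replace (PI - 0) with PI in E2 by ring.
  replace (PI - PI / 2) with (PI / 2) in E2 by field.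
  rewrite Rint_refl in E1, E2; lra.
Qed.

Lemma half_turn_iter (f : R -> R) (P Q : R) :
  (forall x, f (x + P) = f x + Q) -> forall (N : nat) x, f (x + INR N * P) = f x + INR N * Q.
Proof.
  intros H N; induction N as [|N IH]; intros x.
  - simpl; rewrite !Rmult_0_l, !Rplus_0_r; reflexivity.
  - rewrite S_INR; replace (x + (INR N + 1) * P) with ((x + INR N * P) + P) by ring.
    rewrite H, IH; ring.
Qed.

Definition delta (m x : R) : R := sqrt (1 - m * sin x ^ 2).

Lemma sin_sq_bound (x : R) : 0 <= sin x ^ 2 <= 1.
Proof.
  split; [apply pow2_ge_0|]; pose proof (sin2_cos2 x) as H; unfold Rsqr in H.
  pose proof (pow2_ge_0 (cos x)); nra.
Qed.

Lemma sin_sq_shift (x : R) : sin (x + PI) ^ 2 = sin x ^ 2.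
Proof. rewrite neg_sin; ring. Qed.

Lemma sin_sq_reflect (x : R) : sin (PI - x) ^ 2 = sin x ^ 2.
Proof. now rewrite sin_PI_x. Qed.

Lemma cos_sq (x : R) : cos x ^ 2 = 1 - sin x ^ 2.
Proof. pose proof (sin2_cos2 x) as H; unfold Rsqr in H; lra. Qed.

Lemma sin_sq_half_turns (N : nat) (x : R) : sin (x + INR N * PI) ^ 2 = sin x ^ 2.
Proof.
  rewrite (half_turn_iter (fun y => sin y ^ 2) PI 0); [ring|].
  intros y; rewrite sin_sq_shift; ring.
Qed.

Section Amplitude.

Variable m : R.
Hypothesis Hm : 0 < m < 1.

Lemma delta_arg_pos (x : R) : 0 < 1 - m * sin x ^ 2.
Proof. pose proof (sin_sq_bound x); nra. Qed.

Lemma delta_pos (x : R) : 0 < delta m x.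
Proof. apply sqrt_lt_R0, delta_arg_pos. Qed.

Lemma delta_sq (x : R) : delta m x ^ 2 = 1 - m * sin x ^ 2.
Proof. apply pow2_sqrt; left; apply delta_arg_pos. Qed.

Lemma delta_le1 (x : R) : delta m x <= 1.
Proof.
  pose proof (delta_pos x); pose proof (delta_sq x); pose proof (sin_sq_bound x); nra.
Qed.

Lemma delta_deriv (x : R) : derivable_pt_lim (delta m) x (- m * sin x * cos x / delta m x).
Proof.
  pose proof (delta_pos x) as Hd; eapply D_val.
  - apply (D_comp sqrt (fun t => 1 - m * sin t ^ 2)).
    + apply D_minus; [apply D_const|apply D_mult; [apply D_const|]].
      apply D_pow, derivable_pt_lim_sin.
    + apply derivable_pt_lim_sqrt, delta_arg_pos.
  - fold (delta m x); simpl; field; lra.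
Qed.

Lemma amplitude_integrand_continuous : continuity (fun t => / sqrt (1 - m * sin t ^ 2)).
Proof.
  intros x; apply continuity_pt_inv.
  - apply derivable_continuous_pt; eexists; apply (delta_deriv x).
  - pose proof (delta_pos x) as H; unfold delta in H; lra.
Qed.

Lemma ellF_deriv (x : R) : derivable_pt_lim (fun y => ellF y m) x (/ delta m x).
Proof. exact (Rint_deriv _ x amplitude_integrand_continuous). Qed.

Lemma ellF_0 : ellF 0 m = 0.
Proof. apply Rint_refl. Qed.

Lemma ellF_half_turn (x : R) : ellF (x + PI) m = ellF x m + 2 * ellK m.
Proof.
  apply (Rint_half_turn (fun t => / sqrt (1 - m * sin t ^ 2)));
    [apply amplitude_integrand_continuous| |]; intros t.
  - now rewrite sin_sq_shift.
  - now rewrite sin_sq_reflect.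
Qed.

(** The mean value theorem solved for [b - a], in either order of [a] and [b]. Since
    [0 < delta <= 1], it yields injectivity, the growth of [ellF] and the derivative of its
    inverse. *)
Lemma ellF_MVT (a b : R) :
  exists x, Rabs (x - a) <= Rabs (b - a) /\ b - a = delta m x * (ellF b m - ellF a m).
Proof.
  assert (H : forall a b, a < b -> exists x, a < x < b /\ b - a = delta m x * (ellF b m - ellF a m)).
  { intros p q Hpq.
    destruct (MVT_cor2 (fun y => ellF y m) (fun x => / delta m x) p q Hpq) as [x [E Hx]].
    - intros; apply ellF_deriv.
    - exists x; split; [exact Hx|]; cbv beta in E; rewrite E; field.
      pose proof (delta_pos x); lra. }
  destruct (Rtotal_order a b) as [Hab|[->|Hab]].
  - destruct (H a b Hab) as [x [Hx E]]; exists x; split; [|exact E].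
    rewrite !Rabs_pos_eq; lra.
  - exists b; split; [lra|ring].
  - destruct (H b a Hab) as [x [Hx E]]; exists x; split; [|lra].
    rewrite !Rabs_left1; lra.
Qed.

Lemma ellF_inj (a b : R) : ellF a m = ellF b m -> a = b.
Proof. intros H; destruct (ellF_MVT a b) as [x [_ E]]; rewrite H in E; nra. Qed.

(** The integrand is at least 1, so [ellF] is at least as far from 0 as its argument and takes the
    value [v] on [[-|v|, |v|]]. *)
Lemma ellF_surj (v : R) : exists x, ellF x m = v.
Proof.
  assert (Hge : forall x, 0 <= x -> x <= ellF x m).
  { intros x Hx; destruct (ellF_MVT 0 x) as [y [_ E]]; rewrite ellF_0 in E.
    pose proof (delta_pos y); pose proof (delta_le1 y); nra. }
  assert (Hle : forall x, x <= 0 -> ellF x m <= x).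
  { intros x Hx; destruct (ellF_MVT 0 x) as [y [_ E]]; rewrite ellF_0 in E.
    pose proof (delta_pos y); pose proof (delta_le1 y); nra. }
  pose proof (Rabs_pos v); pose proof (Rle_abs v); pose proof (Rle_abs (- v)) as Ha.
  rewrite Rabs_Ropp in Ha.
  destruct (IVT_cor (fun x => ellF x m - v) (- Rabs v) (Rabs v)) as [x [_ E]].
  - intros x; apply derivable_continuous_pt; eexists.
    apply D_minus; [apply ellF_deriv|apply D_const].
  - lra.
  - pose proof (Hge (Rabs v)); pose proof (Hle (- Rabs v)); nra.
  - exists x; lra.
Qed.

Lemma ellF_jam (v : R) : ellF (jam v m) m = v.
Proof. exact (epsilon_spec (inhabits 0) (fun phi => ellF phi m = v) (ellF_surj v)). Qed.

Lemma jam_ellF (x : R) : jam (ellF x m) m = x.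
Proof. apply ellF_inj, ellF_jam. Qed.

Lemma jam_0 : jam 0 m = 0.
Proof. rewrite <- ellF_0 at 1; apply jam_ellF. Qed.

Lemma ellF_half_turns (N : nat) (x : R) : ellF (x + INR N * PI) m = ellF x m + INR N * (2 * ellK m).
Proof. exact (half_turn_iter (fun y => ellF y m) PI (2 * ellK m) ellF_half_turn N x). Qed.

Lemma jam_half_turns (N : nat) (v : R) : jam (v + INR N * (2 * ellK m)) m = jam v m + INR N * PI.
Proof. apply ellF_inj; rewrite ellF_half_turns, !ellF_jam; reflexivity. Qed.

Lemma ellK_pos : 0 < ellK m.
Proof.
  destruct (ellF_MVT 0 (PI / 2)) as [y [_ E]]; rewrite ellF_0 in E.
  pose proof (delta_pos y); pose proof PI_RGT_0; unfold ellK; nra.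
Qed.

(** By [ellF_MVT] the difference quotient is exactly [delta m x] for some [x] within [|h|] of
    [jam v m], so continuity of [delta] finishes. *)
Lemma jam_deriv (v : R) : derivable_pt_lim (fun w => jam w m) v (delta m (jam v m)).
Proof.
  intros eps Heps.
  assert (Hc : continuity_pt (delta m) (jam v m)).
  { apply derivable_continuous_pt; eexists; apply delta_deriv. }
  destruct (Hc eps Heps) as [d [Hd Hcd]].
  exists (mkposreal d Hd); intros h Hh0 Hh; simpl in Hh.
  destruct (ellF_MVT (jam v m) (jam (v + h) m)) as [x [Hx E]].
  rewrite !ellF_jam in E; replace (v + h - v) with h in E by ring.
  replace ((jam (v + h) m - jam v m) / h) with (delta m x) by (rewrite E; field; exact Hh0).
  (* [continuity_pt] only speaks of points different from the base point. *)
  destruct (Req_dec (jam v m) x) as [<-|Hne].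
  - rewrite Rminus_diag, Rabs_R0; exact Heps.
  - apply Hcd; split; [split; [exact I|exact Hne]|].
    apply (Rle_lt_trans _ _ _ Hx); rewrite E, Rabs_mult, (Rabs_pos_eq (delta m x)).
    + pose proof (delta_le1 x); pose proof (Rabs_pos h); simpl; nra.
    + left; apply delta_pos.
Qed.

Lemma jam_eq0_mod_PI (v : R) (N : Z) : jam v m = IZR N * PI -> v = IZR N * (2 * ellK m).
Proof.
  assert (Hn : forall (M : nat), ellF (INR M * PI) m = INR M * (2 * ellK m)).
  { intros M; replace (INR M * PI) with (0 + INR M * PI) by ring.
    rewrite ellF_half_turns, ellF_0; ring. }
  intros E; rewrite <- (ellF_jam v), E; destruct N as [|N|N].
  - rewrite !Rmult_0_l; apply ellF_0.
  - rewrite <- positive_nat_Z, <- INR_IZR_INZ; apply Hn.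
  (* Half turns are counted by naturals, so a negative multiple of [PI] is moved up to 0. *)
  - pose proof (ellF_half_turns (Pos.to_nat N) (IZR (Z.neg N) * PI)) as H.
    assert (EN : IZR (Z.neg N) = - INR (Pos.to_nat N)).
    { rewrite <- Pos2Z.opp_pos, opp_IZR, <- positive_nat_Z, <- INR_IZR_INZ; reflexivity. }
    rewrite EN in *; replace (- INR (Pos.to_nat N) * PI + INR (Pos.to_nat N) * PI) with 0 in H by ring.
    rewrite ellF_0 in H; lra.
Qed.

Variable n : R.
Hypothesis Hn : forall x, 1 - n * sin x ^ 2 <> 0.

Definition third_kind (x : R) : R :=
  Rint (fun t => / ((1 - n * sin t ^ 2) * sqrt (1 - m * sin t ^ 2))) 0 x.

Lemma third_kind_integrand_continuous :
  continuity (fun t => / ((1 - n * sin t ^ 2) * sqrt (1 - m * sin t ^ 2))).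
Proof.
  intros x; apply continuity_pt_inv.
  - apply derivable_continuous_pt; eexists; apply D_mult; [|apply (delta_deriv x)].
    apply D_minus; [apply D_const|apply D_mult; [apply D_const|]].
    apply D_pow, derivable_pt_lim_sin.
  - apply Rmult_integral_contrapositive; split; [apply Hn|].
    pose proof (delta_pos x) as H; unfold delta in H; lra.
Qed.

Lemma third_kind_deriv (x : R) :
  derivable_pt_lim third_kind x (/ ((1 - n * sin x ^ 2) * delta m x)).
Proof. exact (Rint_deriv _ x third_kind_integrand_continuous). Qed.

Lemma third_kind_half_turns (N : nat) (x : R) :
  third_kind (x + INR N * PI) = third_kind x + INR N * (2 * ellPi n m).
Proof.
  apply half_turn_iter; intros y.
  apply (Rint_half_turn (fun t => / ((1 - n * sin t ^ 2) * sqrt (1 - m * sin t ^ 2))));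
    [apply third_kind_integrand_continuous| |]; intros t.
  - now rewrite !sin_sq_shift.
  - now rewrite !sin_sq_reflect.
Qed.

End Amplitude.

(** * Cubics *)

Lemma depressed_cubic_root (p q : R) : exists r, r ^ 3 - p * r + q = 0.
Proof.
  (* A bound with [B^3 >= |p| B + |q|], so that the cubic changes sign on [[-B, B]]. *)
  set (B := 1 + Rabs p + Rabs q).
  pose proof (Rabs_pos p); pose proof (Rabs_pos q).
  pose proof (Rle_abs p); pose proof (Rle_abs q).
  pose proof (Rle_abs (- q)) as Hq'; rewrite Rabs_Ropp in Hq'.
  assert (HB : Rabs p * B + Rabs q <= B ^ 3).
  { assert (E : B ^ 3 = B * B + (Rabs p + Rabs q) * (B * B)) by (unfold B; ring).
    assert (B1 : 1 <= B) by (unfold B; lra).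
    assert (B2 : B <= B * B) by nra.
    rewrite E; nra. }
  destruct (IVT_cor (fun x => x ^ 3 - p * x + q) (- B) B) as [r [_ E]].
  - intros x; apply derivable_continuous_pt; eexists.
    apply D_plus; [apply D_minus; [apply D_pow, D_id|apply D_mult; [apply D_const|apply D_id]]|
      apply D_const].
  - unfold B; lra.
  - assert (0 <= B) by (unfold B; lra).
    assert (Hhi : 0 <= B ^ 3 - p * B + q) by nra.
    assert (Hlo : (- B) ^ 3 - p * - B + q <= 0).
    { replace ((- B) ^ 3 - p * - B + q) with (- (B ^ 3 - p * B - q)) by ring; nra. }
    cbv beta; nra.
  - exists r; exact E.
Qed.

Lemma chi_real (c d mu : R) :
  mu ^ 3 - c / 3 * mu + (d + 9) / 9 = 0 -> chi c d (RtoC mu) = C0.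
Proof. intros E; unfold chi; C_reals; [transitivity (mu ^ 3 - c / 3 * mu + (d + 9) / 9); [ring|exact E]|ring]. Qed.

(** For a real root [r] the discriminant is [(4p - 3r^2)(3r^2 - p)^2], and [4p - 3r^2] is the
    discriminant of the quadratic cofactor [x^2 + r x + r^2 - p]. If it is negative, the cofactor
    has a conjugate pair of roots. *)
Lemma chi_nonreal_root (c d : R) :
  4 * (c / 3) ^ 3 - 27 * ((d + 9) / 9) ^ 2 < 0 ->
  exists mu, chi c d mu = C0 /\ 0 < Im mu.
Proof.
  set (p := c / 3); set (q := (d + 9) / 9); intros Hdisc.
  destruct (depressed_cubic_root p q) as [r Hr].
  assert (E : (4 * p - 3 * r ^ 2) * (3 * r ^ 2 - p) ^ 2 = 4 * p ^ 3 - 27 * q ^ 2).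
  { replace q with (p * r - r ^ 3) by lra; ring. }
  assert (Hneg : 0 < 3 * r ^ 2 - 4 * p) by (pose proof (pow2_ge_0 (3 * r ^ 2 - p)); nra).
  pose proof (sqrt_lt_R0 _ Hneg) as Hs; pose proof (pow2_sqrt _ (Rlt_le _ _ Hneg)) as Hs2.
  set (s := sqrt (3 * r ^ 2 - 4 * p)) in *; clearbody s.
  exists (mkC (- r / 2) (s / 2)); split; [|simpl; lra].
  unfold chi; fold p q; clearbody p q; C_reals.
  - replace q with (p * r - r ^ 3) by lra.
    transitivity (3 * r / 8 * (s ^ 2 - (3 * r ^ 2 - 4 * p))); [field|rewrite Hs2; ring].
  - transitivity (- s / 8 * (s ^ 2 - (3 * r ^ 2 - 4 * p))); [field|rewrite Hs2; ring].
Qed.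

(** In the same factorization one factor vanishes: either the cofactor has the double root [-r/2],
    or [3r^2 = p] and [r] itself is multiple. *)
Lemma chi_double_root (c d : R) :
  4 * (c / 3) ^ 3 - 27 * ((d + 9) / 9) ^ 2 = 0 ->
  exists mu, chi c d (RtoC mu) = C0 /\ 3 * mu ^ 2 = c / 3.
Proof.
  set (p := c / 3); set (q := (d + 9) / 9); intros Hdisc.
  destruct (depressed_cubic_root p q) as [r Hr].
  assert (E : (4 * p - 3 * r ^ 2) * (3 * r ^ 2 - p) ^ 2 = 0).
  { rewrite <- Hdisc; replace q with (p * r - r ^ 3) by lra; ring. }
  apply Rmult_integral in E as [E|E].
  - exists (- r / 2); split; [|lra].
    apply chi_real; fold p q; replace q with (p * r - r ^ 3) by lra.
    replace p with (3 / 4 * r ^ 2) by lra; field.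
  - exists r; split; [now apply chi_real|].
    assert (E' : (3 * r ^ 2 - p) * (3 * r ^ 2 - p) = 0) by lra.
    apply Rmult_integral in E'; lra.
Qed.

Lemma sin_triple (x : R) : sin (3 * x) = 3 * sin x - 4 * sin x ^ 3.
Proof.
  replace (3 * x) with (2 * x + x) by ring; rewrite sin_plus, sin_2a, cos_2a_sin.
  pose proof (sin2_cos2 x) as H; unfold Rsqr in H.
  transitivity (2 * sin x * (cos x * cos x) + (1 - 2 * sin x * sin x) * sin x); [ring|].
  replace (cos x * cos x) with (1 - sin x * sin x) by lra; ring.
Qed.

Lemma rational_nat_denominator (x : R) :
  is_rational x -> exists (p : Z) (q : nat), (0 < q)%nat /\ x = IZR p / INR q.
Proof.
  intros [p [q [Hq ->]]]; destruct (Z.lt_total q 0) as [H|[H|H]]; [|contradiction|].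
  - exists (- p)%Z, (Z.to_nat (- q)); split; [lia|].
    rewrite INR_IZR_INZ, Z2Nat.id, !opp_IZR by lia.
    field; now apply not_0_IZR.
  - exists p, (Z.to_nat q); split; [lia|].
    rewrite INR_IZR_INZ, Z2Nat.id by lia; reflexivity.
Qed.

(** * The curvature of a string *)

Section StringCurvature.

Variables m l u0 : R.
Hypothesis Hm : 0 < m < 1.
Hypothesis Hl : 0 < l.

Definition amplitude (u : R) : R := jam (l * (u + u0)) m.

Definition kap (u : R) : R := kappa_ml m l (u + u0).

Definition kap1 (u : R) : R :=
  - 3 * l ^ 3 * m * (sin (amplitude u) * cos (amplitude u)) * delta m (amplitude u).

(** The values on [kappa_ml] of the first integrals [k'' + 4k^2] ([cc]) and
    [k'^2 - 2 cc k + 8/3 k^3] ([dd]). *)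
Definition cc : R := (1 - m + m ^ 2) * l ^ 4.

Definition dd : R := - (l ^ 6 / 3) * (m + 1) * (2 * m - 1) * (m - 2).

(** Defined by the first integral, so that hypothesis [Hk2] holds by reflexivity; the content lies
    in [kap1_deriv]. *)
Definition kap2 (u : R) : R := cc - 4 * kap u ^ 2.

(** The curvature involves only the square of [sn], whose period is half that of [sn]. *)
Definition curvature_period : R := 2 * ellK m / l.

Lemma kap_amplitude (u : R) :
  kap u = 3 / 2 * l ^ 2 * ((m + 1) / 3 - m * sin (amplitude u) ^ 2).
Proof. reflexivity. Qed.

Lemma amplitude_deriv (u : R) : derivable_pt_lim amplitude u (l * delta m (amplitude u)).
Proof.
  unfold amplitude; eapply D_val.
  - apply (D_comp (fun w => jam w m) (fun t => l * (t + u0))); [|apply jam_deriv, Hm].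
    apply D_mult; [apply D_const|apply D_plus; [apply D_id|apply D_const]].
  - cbv beta; ring.
Qed.

Lemma sin_amplitude_deriv (u : R) :
  derivable_pt_lim (fun t => sin (amplitude t)) u
    (cos (amplitude u) * (l * delta m (amplitude u))).
Proof. apply (D_comp sin amplitude); [apply amplitude_deriv|apply derivable_pt_lim_sin]. Qed.

Lemma cos_amplitude_deriv (u : R) :
  derivable_pt_lim (fun t => cos (amplitude t)) u
    (- sin (amplitude u) * (l * delta m (amplitude u))).
Proof. apply (D_comp cos amplitude); [apply amplitude_deriv|apply derivable_pt_lim_cos]. Qed.

Lemma delta_amplitude_deriv (u : R) :
  derivable_pt_lim (fun t => delta m (amplitude t)) u
    (- m * l * sin (amplitude u) * cos (amplitude u)).
Proof.
  pose proof (delta_pos m Hm (amplitude u)); eapply D_val.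
  - apply (D_comp (delta m) amplitude); [apply amplitude_deriv|apply delta_deriv, Hm].
  - field; lra.
Qed.

Lemma kap_deriv (u : R) : derivable_pt_lim kap u (kap1 u).
Proof.
  apply (derivable_pt_lim_ext
    (fun t => 3 / 2 * l ^ 2 * ((m + 1) / 3 - m * sin (amplitude t) ^ 2))); [reflexivity|].
  eapply D_val.
  - apply D_mult; [apply D_const|apply D_minus; [apply D_const|]].
    apply D_mult; [apply D_const|apply D_pow, sin_amplitude_deriv].
  - unfold kap1; simpl; field.
Qed.

Lemma kap1_deriv (u : R) : derivable_pt_lim kap1 u (kap2 u).
Proof.
  unfold kap1; eapply D_val.
  - apply D_mult; [apply D_mult; [apply D_const|apply D_mult]|].
    + apply sin_amplitude_deriv.
    + apply cos_amplitude_deriv.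
    + apply delta_amplitude_deriv.
  - cbv beta; unfold kap2; rewrite kap_amplitude; unfold cc.
    pose proof (delta_sq m Hm (amplitude u)) as Hd; pose proof (cos_sq (amplitude u)) as Hc.
    set (s := sin (amplitude u)) in *; set (co := cos (amplitude u)) in *.
    set (D := delta m (amplitude u)) in *.
    transitivity (- 3 * l ^ 4 * m * ((co ^ 2 - s ^ 2) * D ^ 2 - m * s ^ 2 * co ^ 2)); [ring|].
    rewrite Hd, Hc; field.
Qed.

Lemma kap_energy (u : R) : kap1 u ^ 2 = 2 * cc * kap u - 8 / 3 * kap u ^ 3 + dd.
Proof.
  unfold kap1; rewrite kap_amplitude; unfold cc, dd.
  pose proof (delta_sq m Hm (amplitude u)) as Hd; pose proof (cos_sq (amplitude u)) as Hc.
  set (s := sin (amplitude u)) in *; set (co := cos (amplitude u)) in *.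
  set (D := delta m (amplitude u)) in *.
  transitivity (9 * l ^ 6 * m ^ 2 * s ^ 2 * co ^ 2 * D ^ 2); [ring|].
  rewrite Hd, Hc; field.
Qed.

Lemma amplitude_periods (N : nat) (u : R) :
  amplitude (u + INR N * curvature_period) = amplitude u + INR N * PI.
Proof.
  unfold amplitude, curvature_period; rewrite <- (jam_half_turns m Hm); f_equal; field; lra.
Qed.

Lemma kap_periods (N : nat) (u : R) : kap (u + INR N * curvature_period) = kap u.
Proof. rewrite !kap_amplitude, amplitude_periods, sin_sq_half_turns; reflexivity. Qed.

Lemma kap1_periods (N : nat) (u : R) : kap1 (u + INR N * curvature_period) = kap1 u.
Proof.
  unfold kap1, delta; rewrite amplitude_periods, sin_sq_half_turns.
  rewrite (half_turn_iter (fun y => sin y * cos y) PI 0); [f_equal; ring|].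
  intros y; rewrite neg_sin, neg_cos; ring.
Qed.

(** At [-u0] the curvature attains its maximum, which it takes only where [sn = 0]; a period must
    carry this point to another zero of [sn]. *)
Lemma period_of_kap (T : R) :
  0 < T -> (forall u, kap (u + T) = kap u) ->
  exists N : nat, (0 < N)%nat /\ T = INR N * curvature_period.
Proof.
  intros HT H; specialize (H (- u0)); rewrite !kap_amplitude in H; unfold amplitude in H.
  replace (l * (- u0 + T + u0)) with (l * T) in H by ring.
  replace (l * (- u0 + u0)) with 0 in H by ring; rewrite (jam_0 m Hm), sin_0 in H.
  assert (Hs : sin (jam (l * T) m) = 0).
  { assert (E : 3 / 2 * l ^ 2 * m * (sin (jam (l * T) m) * sin (jam (l * T) m)) = 0) by lra.
    apply Rmult_integral in E as [E|E]; [|apply Rmult_integral in E; tauto].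
    assert (0 < l ^ 2 * m) by (apply Rmult_lt_0_compat; [apply pow_lt|]; lra); lra. }
  apply sin_eq_0_0 in Hs as [z Hz]; apply (jam_eq0_mod_PI m Hm) in Hz.
  pose proof (ellK_pos m Hm) as HK.
  assert (HlT : 0 < l * T) by nra.
  assert (Hz0 : 0 < IZR z) by nra.
  apply lt_IZR in Hz0.
  exists (Z.to_nat z); split; [lia|].
  rewrite INR_IZR_INZ, Z2Nat.id by lia; unfold curvature_period.
  apply (Rmult_eq_reg_l l); [rewrite Hz; field; lra|lra].
Qed.

Lemma curvature_period_pos : 0 < curvature_period.
Proof.
  pose proof (ellK_pos m Hm); unfold curvature_period.
  apply Rdiv_lt_0_compat; lra.
Qed.

Lemma amplitude_surj (x : R) : exists u, amplitude u = x.
Proof.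
  exists (ellF x m / l - u0); unfold amplitude.
  replace (l * (ellF x m / l - u0 + u0)) with (ellF x m) by (field; lra).
  apply jam_ellF, Hm.
Qed.

(** * The angle of a real eigenfunction *)

Section Angle.

Variable lam : R.
Hypothesis Hlam : chi cc dd (RtoC (lam / 2)) = C0.

Let Dn : R := 2 * (1 + m) * l ^ 2 + 3 * lam.
Let n : R := 6 * m * l ^ 2 / Dn.

Lemma shift_amplitude (u : R) :
  2 / 3 * kap u + lam / 2 = (Dn - 6 * m * l ^ 2 * sin (amplitude u) ^ 2) / 6.
Proof. rewrite kap_amplitude; unfold Dn; field. Qed.

(** Along the curve this is [6 (2k/3 + lam/2)], which has no zero, and every real [x] is a value of
    the amplitude. *)
Lemma angle_denominator_neq0 (x : R) : Dn - 6 * m * l ^ 2 * sin x ^ 2 <> 0.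
Proof.
  destruct (amplitude_surj x) as [u <-]; intros E.
  apply (real_shift_neq0 kap kap1 kap2 cc dd (fun _ => eq_refl) kap_energy (lam / 2) Hlam u).
  rewrite shift_amplitude, E; field.
Qed.

Lemma Dn_neq0 : Dn <> 0.
Proof.
  intros E; apply (angle_denominator_neq0 0); rewrite sin_0, E; ring.
Qed.

Lemma characteristic_neq0 (x : R) : 1 - n * sin x ^ 2 <> 0.
Proof.
  intros E; apply (angle_denominator_neq0 x); pose proof Dn_neq0.
  transitivity (Dn * (1 - n * sin x ^ 2)); [unfold n; field; assumption|rewrite E; ring].
Qed.

(** A primitive of [1/g] with [g = 2k/3 + lam/2]: substitute the amplitude [x], with
    [du = dx / (l delta)] and [6 g = Dn (1 - n sin^2 x)]. *)
Definition angle (u : R) : R :=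
  6 / (Dn * l) * third_kind m n (amplitude u).

Lemma angle_deriv (u : R) : derivable_pt_lim angle u (/ (2 / 3 * kap u + lam / 2)).
Proof.
  unfold angle; eapply D_val.
  - apply D_mult; [apply D_const|].
    apply (D_comp (third_kind m n) amplitude); [apply amplitude_deriv|].
    apply third_kind_deriv; [exact Hm|exact characteristic_neq0].
  - cbv beta; rewrite shift_amplitude.
    pose proof (delta_pos m Hm (amplitude u)); pose proof Dn_neq0.
    pose proof (characteristic_neq0 (amplitude u)) as H1.
    replace (Dn - 6 * m * l ^ 2 * sin (amplitude u) ^ 2)
      with (Dn * (1 - n * sin (amplitude u) ^ 2)) by (unfold n; field; assumption).
    field; repeat split; try assumption; lra.
Qed.

Lemma angle_periods (N : nat) (u : R) :
  angle (u + INR N * curvature_period) = angle u + INR N * (2 * PI * Theta lam m l).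
Proof.
  unfold angle; rewrite amplitude_periods, (third_kind_half_turns m Hm n characteristic_neq0).
  unfold Theta; fold Dn; fold n; pose proof PI_RGT_0; pose proof Dn_neq0.
  field; repeat split; try assumption; lra.
Qed.

End Angle.

(* The product of the g_j is - (1 + k'^2/9) and their second symmetric function is - k''/3, so
   that the angles add up to atan (k'/3), which is periodic. *)
Lemma Theta_sum (lam1 lam2 lam3 : R) :
  chi cc dd (RtoC (lam1 / 2)) = C0 -> chi cc dd (RtoC (lam2 / 2)) = C0 ->
  chi cc dd (RtoC (lam3 / 2)) = C0 ->
  lam1 + lam2 + lam3 = 0 ->
  lam1 * lam2 + lam2 * lam3 + lam3 * lam1 = - (4 / 3) * cc ->
  lam1 * lam2 * lam3 = - (8 / 9) * (dd + 9) ->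
  Theta lam1 m l + Theta lam2 m l + Theta lam3 m l = 0.
Proof.
  intros H1 H2 H3 S1 S2 S3.
  assert (D : forall u, derivable_pt_lim
    (fun t => angle lam1 t + angle lam2 t + angle lam3 t - atan (kap1 t / 3)) u 0).
  { intros u; eapply D_val.
    - apply D_minus.
      + apply D_plus; [apply D_plus|]; apply angle_deriv; assumption.
      + apply (D_comp atan (fun t => kap1 t / 3)); [|apply derivable_pt_lim_atan].
        apply D_div; [apply kap1_deriv|apply D_const|lra].
    - pose proof (real_shift_neq0 kap kap1 kap2 cc dd (fun _ => eq_refl) kap_energy) as Hne.
      pose proof (Hne _ H1 u) as N1; pose proof (Hne _ H2 u) as N2; pose proof (Hne _ H3 u) as N3.
      set (g1 := 2 / 3 * kap u + lam1 / 2) in *; set (g2 := 2 / 3 * kap u + lam2 / 2) in *.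
      set (g3 := 2 / 3 * kap u + lam3 / 2) in *.
      assert (P3 : 1 + (kap1 u / 3) ^ 2 = - (g1 * g2 * g3)).
      { replace (1 + (kap1 u / 3) ^ 2) with (1 + kap1 u ^ 2 / 9) by field.
        rewrite kap_energy; unfold g1, g2, g3.
        transitivity (- ((2 / 3 * kap u) ^ 3 + (2 / 3 * kap u) ^ 2 * (lam1 + lam2 + lam3) / 2
          + 2 / 3 * kap u * (lam1 * lam2 + lam2 * lam3 + lam3 * lam1) / 4
          + lam1 * lam2 * lam3 / 8)); [rewrite S1, S2, S3; field|field]. }
      assert (P2 : kap2 u = - 3 * (g2 * g3 + g1 * g3 + g1 * g2)).
      { unfold kap2, g1, g2, g3.
        transitivity (- 3 * (3 * (2 / 3 * kap u) ^ 2 + (2 / 3 * kap u) * (lam1 + lam2 + lam3)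
          + (lam1 * lam2 + lam2 * lam3 + lam3 * lam1) / 4)); [rewrite S1, S2; field|field]. }
      rewrite P3, P2; field; repeat split; assumption. }
  (* One period, in the shape to which [angle_periods] and [kap1_periods] apply. *)
  pose proof (derivative_zero_constant _ D (0 + INR 1 * curvature_period) 0) as E; cbv beta in E.
  rewrite !angle_periods, kap1_periods in E by assumption.
  simpl INR in E; pose proof PI_RGT_0.
  assert (E' : 2 * PI * (Theta lam1 m l + Theta lam2 m l + Theta lam3 m l) = 0) by lra.
  apply Rmult_integral in E' as [E'|E']; lra.
Qed.

(** * The roots of the characteristic polynomial *)

Let PP : R := (m - 2) * (1 + m) * (2 * m - 1) * l ^ 6.

Lemma pp_discriminant : pp m l = 64 * (4 * (cc / 3) ^ 3 - 27 * ((dd + 9) / 9) ^ 2).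
Proof. unfold pp, cc, dd; field. Qed.

Lemma sigma_sq : sigma m ^ 2 = 1 - m + m ^ 2.
Proof. apply pow2_sqrt; nra. Qed.

Lemma sigma_pos : 0 < sigma m.
Proof. apply sqrt_lt_R0; nra. Qed.

Definition lambda1 : R := - lambda2 m l - lambda3 m l.

Section PositiveDiscriminant.

Hypothesis Hpp : pp m l > 0.

(** Positivity of [pp] says [(PP - 27)^2 < (2 sigma^3 l^6)^2], by the identity [4 sigma^6 -
    ((m-2)(1+m)(2m-1))^2 = 27 m^2 (m-1)^2]. *)
Lemma ptilde_bound : -1 <= ptilde m l <= 1.
Proof.
  pose proof sigma_pos as Hs; pose proof sigma_sq as Hs2.
  assert (Hd : 0 < 2 * sigma m ^ 3 * l ^ 6).
  { apply Rmult_lt_0_compat; [apply Rmult_lt_0_compat; [lra|]|]; apply pow_lt; assumption. }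
  assert (E : ptilde m l * (2 * sigma m ^ 3 * l ^ 6) = PP - 27).
  { unfold ptilde, PP; field; split; lra. }
  assert (H : (PP - 27) ^ 2 < (2 * sigma m ^ 3 * l ^ 6) ^ 2).
  { replace ((2 * sigma m ^ 3 * l ^ 6) ^ 2) with (4 * (sigma m ^ 2) ^ 3 * l ^ 12) by ring.
    rewrite Hs2; pose proof Hpp as Hp; rewrite pp_discriminant in Hp.
    assert (E1 : 64 * (4 * (cc / 3) ^ 3 - 27 * ((dd + 9) / 9) ^ 2)
      = 64 / 27 * (4 * (1 - m + m ^ 2) ^ 3 * l ^ 12 - (PP - 27) ^ 2))
      by (unfold cc, dd, PP; field).
    lra. }
  set (w := 2 * sigma m ^ 3 * l ^ 6) in *; rewrite <- E in H.
  set (t := ptilde m l) in *.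
  assert (H' : (t * t) * w ^ 2 < 1 * w ^ 2) by lra.
  apply Rmult_lt_reg_r in H'; [nra|nra].
Qed.

(** The trigonometric solution of the cubic [8 chi(lambda/2) = 0]: the amplitude [(4/3) sigma l^2]
    makes it the triple-angle formula for [sin (3 alpha) = ptilde]. *)
Lemma lambda2_cubic : lambda2 m l ^ 3 - 4 / 3 * cc * lambda2 m l + 8 / 9 * (dd + 9) = 0.
Proof.
  pose proof (sin_asin _ ptilde_bound) as H.
  pose proof (sin_triple (alpha m l)) as H3.
  replace (3 * alpha m l) with (asin (ptilde m l)) in H3 by (unfold alpha; field).
  rewrite H in H3; pose proof sigma_pos as Hs; pose proof sigma_sq as Hs2.
  assert (E : ptilde m l * (2 * sigma m ^ 3 * l ^ 6) = PP - 27).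
  { unfold ptilde, PP; field; split; lra. }
  rewrite H3 in E; unfold lambda2, cc, dd; rewrite <- Hs2.
  transitivity (8 / 27 * ((3 * sin (alpha m l) - 4 * sin (alpha m l) ^ 3)
    * (2 * sigma m ^ 3 * l ^ 6) - (PP - 27))); [unfold PP; field|rewrite E; ring].
Qed.

(** Both are [(4/3) sigma l^2] times sines with phases 120 degrees apart. The left side is the
    divided difference of [x^3] at the two values, so with [lambda2_cubic] it gives all symmetric
    functions of the roots. *)
Lemma lambda23_quadratic :
  lambda3 m l ^ 2 + lambda2 m l * lambda3 m l + lambda2 m l ^ 2 = 4 / 3 * cc.
Proof.
  pose proof (sqrt_lt_R0 3 ltac:(lra)) as H3; pose proof (pow2_sqrt 3 ltac:(lra)) as H3'.
  unfold lambda2, lambda3, cc; rewrite <- sigma_sq.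
  set (s := sin (alpha m l)); pose proof (cos_sq (alpha m l)) as Hc; fold s in Hc.
  set (co := cos (alpha m l)) in *.
  transitivity ((4 / 3 * s ^ 2 + 4 / sqrt 3 ^ 2 * co ^ 2) * sigma m ^ 2 * l ^ 4);
    [field; lra|rewrite H3', Hc; field].
Qed.

Lemma lambda_symmetric :
  lambda1 * lambda2 m l + lambda2 m l * lambda3 m l + lambda3 m l * lambda1 = - (4 / 3) * cc /\
  lambda1 * lambda2 m l * lambda3 m l = - (8 / 9) * (dd + 9).
Proof.
  pose proof lambda2_cubic as H2; pose proof lambda23_quadratic as H23; unfold lambda1.
  split; [lra|].
  replace (4 / 3 * cc) with (lambda3 m l ^ 2 + lambda2 m l * lambda3 m l + lambda2 m l ^ 2) in H2.
  lra.
Qed.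

Lemma lambda_roots :
  chi cc dd (RtoC (lambda1 / 2)) = C0 /\ chi cc dd (RtoC (lambda2 m l / 2)) = C0 /\
  chi cc dd (RtoC (lambda3 m l / 2)) = C0.
Proof.
  destruct lambda_symmetric as [S2 S3]; unfold lambda1 in *.
  set (x := lambda2 m l) in *; set (y := lambda3 m l) in *.
  repeat split; apply chi_real;
    (replace cc with (3 / 4 * (x ^ 2 + x * y + y ^ 2)) by lra);
    (replace (dd + 9) with (9 / 8 * ((x + y) * x * y)) by lra); field.
Qed.

(** The square of this product is exactly [pp]; the factor [64 = 2^6] comes from
    [lambda_j = 2 mu_j]. *)
Lemma lambda_distinct :
  (lambda1 - lambda2 m l) * (lambda2 m l - lambda3 m l) * (lambda3 m l - lambda1) <> 0.
Proof.
  intros E; destruct lambda_symmetric as [S2 S3]; pose proof Hpp as Hp.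
  rewrite pp_discriminant in Hp; unfold lambda1 in *.
  set (x := lambda2 m l) in *; set (y := lambda3 m l) in *.
  assert (E' : 64 * (4 * (cc / 3) ^ 3 - 27 * ((dd + 9) / 9) ^ 2) =
    ((- x - y - x) * (x - y) * (y - (- x - y))) ^ 2).
  { replace cc with (3 / 4 * (x ^ 2 + x * y + y ^ 2)) by lra.
    replace (dd + 9) with (9 / 8 * ((x + y) * x * y)) by lra; field. }
  rewrite E', E in Hp; lra.
Qed.

End PositiveDiscriminant.

(** * Closed strings *)

Section StringLift.

Variables (gamma : R -> C3) (G : nat -> R -> C3).
Hypothesis HG : normalized_natural_lift G.
Hypothesis Hgamma : forall u, proj_eq (G 0 u) (gamma u).
Hypothesis Hcurv : forall u, cr_curvature G u = kap u.

Lemma string_ode (p : C3 -> C) :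
  coordinate p ->
  derivC (fun u => p (G 2 u))
    (fun u => (Ci - RtoC (kap1 u)) * p (G 0 u) - RtoC (2 * kap u) * p (G 1 u))%cx.
Proof.
  intros Hp; eapply derivC_ext; [now apply lift_coordinate_deriv|].
  intros u; cbv beta; rewrite <- Hcurv; apply lift_third_derivative; [exact HG| |exact Hp].
  intros v; apply (derivable_pt_lim_ext kap); [symmetry; apply Hcurv|apply kap_deriv].
Qed.

Definition eig (mu : C) (p : C3 -> C) : R -> C :=
  eigenfunction kap kap1 mu (fun u => p (G 0 u)) (fun u => p (G 1 u)) (fun u => p (G 2 u)).

(** The coefficient [i - k'/3] of the first derivative is never zero and the frame is
    independent. *)
Lemma eig_not_all_zero (mu : C) (u : R) : ~ (forall p, coordinate p -> eig mu p u = C0).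
Proof.
  intros H.
  pose proof (coordinate_wronskian G HG u _ (Ci - RtoC (kap1 u / 3))%cx _ H) as E.
  apply (f_equal Im) in E; simpl in E; lra.
Qed.

Lemma eig_nonzero_coordinate (mu : C) (u : R) : exists p, coordinate p /\ eig mu p u <> C0.
Proof.
  destruct (excluded_middle_informative (exists p, coordinate p /\ eig mu p u <> C0)) as [?|H];
    [assumption|].
  destruct (eig_not_all_zero mu u); intros p Hp.
  destruct (excluded_middle_informative (eig mu p u = C0)); [assumption|].
  destruct H; exists p; split; assumption.
Qed.

Lemma eig_periods (lam : R) (p : C3 -> C) (N : nat) (u : R) :
  chi cc dd (RtoC (lam / 2)) = C0 -> coordinate p ->
  eig (RtoC (lam / 2)) p (u + INR N * curvature_period)
  = (cis (INR N * (2 * PI * Theta lam m l)) * eig (RtoC (lam / 2)) p u)%cx.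
Proof.
  intros Hlam Hp.
  apply (real_eigenfunction_translation kap kap1 kap2 cc dd)
    with (theta := angle lam).
  - apply kap_deriv.
  - apply kap1_deriv.
  - reflexivity.
  - apply kap_energy.
  - now apply lift_coordinate_deriv.
  - now apply lift_coordinate_deriv.
  - now apply string_ode.
  - exact Hlam.
  - intros v; now apply angle_deriv.
  - intros v; apply kap_periods.
  - intros v; now apply angle_periods.
Qed.

Lemma closed_string_translation :
  closed_curve gamma ->
  exists (N : nat) (c : C), (0 < N)%nat /\ (c * c * c)%cx = Cone /\ Cnorm2 c = 1 /\
    forall p, coordinate p ->
      p (G 0 (INR N * curvature_period)) = (c * p (G 0 0))%cx /\
      p (G 1 (INR N * curvature_period)) = (c * p (G 1 0))%cx /\
      p (G 2 (INR N * curvature_period)) = (c * p (G 2 0))%cx.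
Proof.
  intros [T [HT Hcl]].
  assert (H : forall u, exists a, G 0 (u + T) = scale3 a (G 0 u)).
  { intros u; destruct (Hgamma u) as [_ [a [_ Ea]]], (Hgamma (u + T)) as [_ [a' [Ha' Ea']]].
    destruct (Hcl u) as [_ [b [_ Eb]]].
    (* The route [G 0 u], [gamma u], [gamma (u + T)], [G 0 (u + T)]; the last comparison is
       inverted. *)
    exists (Cinv a' * (b * a))%cx.
    assert (E : G 0 (u + T) = scale3 (Cinv a') (scale3 a' (G 0 (u + T)))).
    { pose proof (Cinv_l a' Ha') as Hi.
      apply C3_eq; simpl.
      - transitivity (Cinv a' * a' * c1 (G 0%nat (u + T)%R))%cx; [rewrite Hi|]; ring.
      - transitivity (Cinv a' * a' * c2 (G 0%nat (u + T)%R))%cx; [rewrite Hi|]; ring.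
      - transitivity (Cinv a' * a' * c3 (G 0%nat (u + T)%R))%cx; [rewrite Hi|]; ring. }
    rewrite E, <- Ea', Eb, Ea; apply C3_eq; simpl; ring. }
  destruct (lift_translation G HG T H) as [c [Hc3 [Hn Ht]]].
  assert (HkT : forall u, kap (u + T) = kap u).
  { intros u; rewrite <- !Hcurv; apply (cr_curvature_translation G T (c u)); [apply Hn|].
    intros p Hp; now apply Ht. }
  destruct (period_of_kap T HT HkT) as [N [HN E]].
  exists N, (c 0); split; [exact HN|split; [apply Hc3|split; [apply Hn|]]].
  intros p Hp; rewrite <- E; replace T with (0 + T) by ring; now apply Ht.
Qed.

(** In both excluded cases the non-periodicity lemmas force the eigenfunction of every coordinate to
    vanish at 0, against [eig_not_all_zero]. *)
Lemma closed_string_pp_pos : closed_curve gamma -> pp m l > 0.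
Proof.
  intros Hcl; destruct (closed_string_translation Hcl) as [N [c [HN [_ [Hc Ht]]]]].
  set (T := INR N * curvature_period) in *.
  assert (HT : 0 < T).
  { apply Rmult_lt_0_compat; [now apply lt_0_INR|apply curvature_period_pos]. }
  assert (HkT : kap T = kap 0) by (rewrite <- (kap_periods N 0), Rplus_0_l; reflexivity).
  assert (Hk1T : kap1 T = kap1 0) by (rewrite <- (kap1_periods N 0), Rplus_0_l; reflexivity).
  destruct (Rtotal_order (pp m l) 0) as [Hpp|[Hpp|Hpp]]; [exfalso|exfalso|exact Hpp].
  - rewrite pp_discriminant in Hpp.
    destruct (chi_nonreal_root cc dd ltac:(lra)) as [mu [Hmu Him]].
    apply (eig_not_all_zero mu 0); intros p Hp; destruct (Ht p Hp) as [E0 [E1 E2]].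
    apply (nonreal_eigenfunction_not_periodic kap kap1 kap2 cc dd) with (T := T); try assumption.
    + apply kap_deriv.
    + apply kap1_deriv.
    + reflexivity.
    + apply kap_energy.
    + now apply lift_coordinate_deriv.
    + now apply lift_coordinate_deriv.
    + now apply string_ode.
    + fold (eig mu p).
      transitivity (Cnorm2 (c * eig mu p 0)%cx); [f_equal|rewrite Cnorm2_mul, Hc; ring].
      unfold eig, eigenfunction, shifted_curvature; cbv zeta.
      rewrite HkT, Hk1T, E0, E1, E2; ring.
  - rewrite pp_discriminant in Hpp.
    destruct (chi_double_root cc dd ltac:(lra)) as [mu [Hmu Hdbl]].
    apply (eig_not_all_zero (RtoC mu) 0); intros p Hp; destruct (Ht p Hp) as [E0 [E1 E2]].
    apply (double_eigenvalue_not_periodic kap kap1 kap2 cc dd) with (T := T) (a := c);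
      try assumption.
    + apply kap_deriv.
    + apply kap1_deriv.
    + reflexivity.
    + apply kap_energy.
    + now apply lift_coordinate_deriv.
    + now apply lift_coordinate_deriv.
    + now apply string_ode.
Qed.

(** On a coordinate with nonzero eigenfunction, the factor of [N] curvature periods is both [c] and
    [cis (2 PI N Theta)]. As [c^3 = 1], [3 N Theta] is an integer. *)
Lemma closed_string_Theta_rational (lam : R) :
  closed_curve gamma -> chi cc dd (RtoC (lam / 2)) = C0 -> is_rational (Theta lam m l).
Proof.
  intros Hcl Hlam; destruct (closed_string_translation Hcl) as [N [c [HN [Hc3 [_ Ht]]]]].
  destruct (eig_nonzero_coordinate (RtoC (lam / 2)) 0) as [p [Hp Hne]].
  pose proof (eig_periods lam p N 0 Hlam Hp) as E; rewrite Rplus_0_l in E.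
  assert (Ec : eig (RtoC (lam / 2)) p (INR N * curvature_period)
    = (c * eig (RtoC (lam / 2)) p 0)%cx).
  { destruct (Ht p Hp) as [E0 [E1 E2]].
    pose proof (kap_periods N 0) as HkT; pose proof (kap1_periods N 0) as Hk1T.
    rewrite Rplus_0_l in HkT, Hk1T.
    unfold eig, eigenfunction, shifted_curvature; cbv zeta.
    rewrite HkT, Hk1T, E0, E1, E2; ring. }
  rewrite Ec in E.
  set (x := INR N * (2 * PI * Theta lam m l)) in *.
  assert (Ecis : cis x = c).
  { destruct (Cmul_integral (c - cis x)%cx (eig (RtoC (lam / 2)) p 0)) as [E'|E'].
    - transitivity (c * eig (RtoC (lam / 2)) p 0 - cis x * eig (RtoC (lam / 2)) p 0)%cx;
        [ring|rewrite E; ring].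
    - transitivity (c - (c - cis x))%cx; [ring|rewrite E'; ring].
    - contradiction. }
  destruct (cis_eq1 (x + x + x)) as [z Hz].
  { rewrite !cis_add, Ecis; exact Hc3. }
  assert (HN0 : 0 < INR N) by (now apply lt_0_INR).
  exists z, (3 * Z.of_nat N)%Z; split; [lia|].
  rewrite mult_IZR, <- INR_IZR_INZ; unfold x in Hz; pose proof PI_RGT_0.
  apply (Rmult_eq_reg_r (6 * PI * INR N)); [|nra].
  transitivity (2 * IZR z * PI); [rewrite <- Hz; ring|field; lra].
Qed.

(* The eigenfunctions are Y_j = mu_j^2 z + mu_j (..) + (..), so z is their second divided
   difference with respect to mu. *)
Lemma rational_string_closed :
  pp m l > 0 -> is_rational (Theta2 m l) -> is_rational (Theta3 m l) -> closed_curve gamma.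
Proof.
  intros Hpp [a2 [b2 [Hb2 E2]]]%rational_nat_denominator [a3 [b3 [Hb3 E3]]]%rational_nat_denominator.
  destruct (lambda_roots Hpp) as [R1 [R2 R3]].
  destruct (lambda_symmetric Hpp) as [S2 S3].
  assert (S1 : lambda1 + lambda2 m l + lambda3 m l = 0) by (unfold lambda1; ring).
  pose proof (Theta_sum _ _ _ R1 R2 R3 S1 S2 S3) as Hsum.
  fold (Theta2 m l) in Hsum; fold (Theta3 m l) in Hsum.
  (* A common denominator of [Theta2] and [Theta3]; by [Theta_sum] it also serves the remaining root
     [lambda1]. *)
  set (N := (b2 * b3)%nat).
  assert (Hb2' : 0 < INR b2) by (now apply lt_0_INR).
  assert (Hb3' : 0 < INR b3) by (now apply lt_0_INR).
  assert (Z2 : INR N * Theta2 m l = IZR (a2 * Z.of_nat b3)).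
  { unfold N; rewrite E2, mult_INR, mult_IZR, <- INR_IZR_INZ; field; lra. }
  assert (Z3 : INR N * Theta3 m l = IZR (a3 * Z.of_nat b2)).
  { unfold N; rewrite E3, mult_INR, mult_IZR, <- INR_IZR_INZ; field; lra. }
  assert (Z1 : INR N * Theta lambda1 m l = IZR (- (a2 * Z.of_nat b3 + a3 * Z.of_nat b2))).
  { rewrite opp_IZR, plus_IZR, <- Z2, <- Z3.
    replace (Theta lambda1 m l) with (- (Theta2 m l + Theta3 m l)) by lra; ring. }
  set (T := INR N * curvature_period).
  assert (HT : 0 < T).
  { apply Rmult_lt_0_compat; [|apply curvature_period_pos].
    unfold N; rewrite mult_INR; now apply Rmult_lt_0_compat. }
  assert (Hper : forall lam z p u, chi cc dd (RtoC (lam / 2)) = C0 ->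
    INR N * Theta lam m l = IZR z -> coordinate p ->
    eig (RtoC (lam / 2)) p (u + T) = eig (RtoC (lam / 2)) p u).
  { intros lam z p u Hlam Hz Hp; unfold T; rewrite eig_periods by assumption.
    replace (INR N * (2 * PI * Theta lam m l)) with (2 * PI * IZR z) by (rewrite <- Hz; ring).
    rewrite cis_2PI_IZR; ring. }
  set (x1 := RtoC (lambda1 / 2)) in *; set (x2 := RtoC (lambda2 m l / 2)) in *.
  set (x3 := RtoC (lambda3 m l / 2)) in *.
  set (V := ((x1 - x2) * (x2 - x3) * (x3 - x1))%cx).
  assert (HV : V <> C0).
  { intros E; apply (lambda_distinct Hpp); apply (f_equal Re) in E.
    unfold V, x1, x2, x3 in E; simpl in E; lra. }
  assert (Hlag : forall p u, (V * p (G 0%nat u))%cx =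
    (- ((x2 - x3) * eig x1 p u + (x3 - x1) * eig x2 p u + (x1 - x2) * eig x3 p u))%cx).
  { intros p u; unfold V, eig, eigenfunction, shifted_curvature; cbv zeta; ring. }
  assert (HG0 : forall u, G 0 (u + T) = G 0 u).
  { intros u.
    assert (E : forall p, coordinate p -> p (G 0 (u + T)) = p (G 0 u)).
    { intros p Hp.
      assert (EV : (V * p (G 0%nat (u + T)%R))%cx = (V * p (G 0%nat u))%cx).
      { rewrite !Hlag; unfold x1, x2, x3.
        rewrite (Hper lambda1 _ p u R1 Z1 Hp), (Hper _ _ p u R2 Z2 Hp), (Hper _ _ p u R3 Z3 Hp).
        reflexivity. }
      pose proof (Cinv_l V HV) as Hi.
      transitivity (Cinv V * (V * p (G 0%nat (u + T)%R)))%cx.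
      - transitivity (Cinv V * V * p (G 0%nat (u + T)%R))%cx; [rewrite Hi|]; ring.
      - rewrite EV; transitivity (Cinv V * V * p (G 0%nat u))%cx; [|rewrite Hi]; ring. }
    apply C3_eq; apply E; unfold coordinate; auto. }
  exists T; split; [exact HT|intros u].
  destruct (Hgamma u) as [Hz [a [Ha Ea]]], (Hgamma (u + T)) as [_ [a' [Ha' Ea']]].
  pose proof (Cinv_l a Ha) as Hi; rewrite HG0 in Ea'; split.
  (* [proj_eq] demands a nonzero representative: [gamma u = 0] would make the lift vanish. *)
  - intros E0; rewrite E0 in Ea; apply Hz.
    apply C3_eq; simpl.
    + transitivity (Cinv a * c1 (scale3 a (G 0%nat u)))%cx; [simpl|rewrite <- Ea; simpl; ring].
      transitivity (Cinv a * a * c1 (G 0%nat u))%cx; [rewrite Hi|]; ring.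
    + transitivity (Cinv a * c2 (scale3 a (G 0%nat u)))%cx; [simpl|rewrite <- Ea; simpl; ring].
      transitivity (Cinv a * a * c2 (G 0%nat u))%cx; [rewrite Hi|]; ring.
    + transitivity (Cinv a * c3 (scale3 a (G 0%nat u)))%cx; [simpl|rewrite <- Ea; simpl; ring].
      transitivity (Cinv a * a * c3 (G 0%nat u))%cx; [rewrite Hi|]; ring.
  - exists (a' * Cinv a)%cx; split; [apply Cmul_neq0; [exact Ha'|now apply Cinv_neq0]|].
    rewrite Ea', Ea; apply C3_eq; simpl.
    + transitivity (a' * (Cinv a * a) * c1 (G 0%nat u))%cx; [rewrite Hi|]; ring.
    + transitivity (a' * (Cinv a * a) * c2 (G 0%nat u))%cx; [rewrite Hi|]; ring.
    + transitivity (a' * (Cinv a * a) * c3 (G 0%nat u))%cx; [rewrite Hi|]; ring.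
Qed.

End StringLift.

End StringCurvature.

Theorem mainTheorem7 (gamma : R -> C3) (m l : R) :
  0 < m < 1 -> 0 < l ->
  is_string_with_characters gamma m l ->
  (closed_curve gamma <->
   (pp m l > 0 /\ is_rational (Theta2 m l) /\ is_rational (Theta3 m l))).
Proof.
  intros Hm Hl [G [HG [Hgamma [_ [_ [_ [u0 Hcurv]]]]]]]; split.
  - intros Hcl.
    pose proof (closed_string_pp_pos m l u0 Hm Hl gamma G HG Hgamma Hcurv Hcl) as Hpp.
    destruct (lambda_roots m l Hm Hl Hpp) as [_ [R2 R3]].
    split; [exact Hpp|split];
      apply (closed_string_Theta_rational m l u0 Hm Hl gamma G HG Hgamma Hcurv); assumption.
  - intros [Hpp [H2 H3]].
    exact (rational_string_closed m l u0 Hm Hl gamma G HG Hgamma Hcurv Hpp H2 H3).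
Qed.
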